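(* Let $A$ be a commutative ring, let $f\in A$ be a nonzerodivisor, let $B=A_f$, and let $G$ be the affine group scheme over $A$ with Hopf algebra $S=A[T,T^{-1},X]/(T-1-fX)$ described in the context. Let $\mathrm{Rep}(G)_f$, $\mathcal C$ and the functor $F:\mathrm{Rep}(G)_f\to\mathcal C$, $FM=(B\otimes_A M,\,M)$, be as described in the context. Then $F:\mathrm{Rep}(G)_f\to\mathcal C$ is an equivalence of categories.
   Context: $A$ is a commutative ring, $f\in A$ a nonzerodivisor, and $B:=A_f$ is the localization of $A$ at $\{f^n:n\ge 0\}$; $A$ is identified with a subring of $B$. The group scheme $G$: for a commutative $A$-algebra $R$, $G(R)=\{(t,x)\in R^\times\times R: t-1=fx\}$, with multiplication $(t,x)(t',x')=(tt',x+x'+fxx')$, identity $(1,0)$ and inverse $(t,x)^{-1}=(t^{-1},-t^{-1}x)$. It is represented by the commutative Hopf $A$-algebra $S=A[T,T^{-1},X]/(T-1-fX)$ (so the comultiplication sends $T\mapsto T\otimes T$ and $X\mapsto X\otimes 1+1\otimes X+fX\otimes X$), which is flat over $A$. The homomorphism $G\to\mathbb G_m$, $(t,x)\mapsto t$, becomes an isomorphism over $B$, giving $B\otimes_A S\cong B[T,T^{-1}]$ as Hopf algebras, where $T$ is group-like. $\mathrm{Rep}(G)$ is the category of $S$-comodules, with comultiplication maps of the form $M\to S\otimes_A M$. $\mathrm{Rep}(G)_f$ is the full subcategory of $S$-comodules $M$ such that $f$ is a nonzerodivisor on the underlying $A$-module of $M$ (multiplication by $f$ on $M$ is injective). For a $\mathbb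 Z$-graded $B$-module $N=\bigoplus_{i\in\mathbb Z}N_i$ and an integer $n\ge 0$, let $C_n:N\to N$ be the graded $B$-linear endomorphism acting on $N_i$ as multiplication by $f^n\binom{i}{n}$, where $\binom{i}{n}=i(i-1)\cdots(i-n+1)/n!$ for all $i\in\mathbb Z$ (and $\binom{i}{0}=1$). $\mathcal C$ is the category whose objects are pairs $(N,M)$, where $N$ is a $\mathbb Z$-graded $B$-module and $M$ is an $A$-submodule of $N$ such that the natural map $B\otimes_A M\to N$ is an isomorphism and $C_nM\subset M$ for all $n\ge 0$. A morphism $(N,M)\to(N',M')$ is a homomorphism $\phi:N\to N'$ of graded $B$-modules with $\phi M\subset M'$. The functor $F$: for $M$ in $\mathrm{Rep}(G)_f$, $N:=B\otimes_A M$ is a $B[T,T^{-1}]$-comodule by extension of scalars, hence carries a $\mathbb Z$-grading $N=\bigoplus_i N_i$ for which the comultiplication $N\to B[T,T^{-1}]\otimes_B N$ is $\sum_i x_i\mapsto\sum_i T^i\otimes x_i$ ($x_i\in N_i$). Since $f$ is a nonzerodivisor on $M$, the canonical map $M\to N$, $m\mapsto 1\otimes m$, identifies $M$ with an $A$-submodule of $N$, and one has $C_nM\subset M$ for all $n\ge 0$. Put $FM:=(N,M)$; on morphisms, $F$ is given by extension of scalars to $B$. *)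

(* Defs.v *)
From HB Require Import structures.
From mathcomp Require Import all_boot all_order all_algebra generic_quotient.
From mathcomp Require Import ring.
From mathcomp Require Import boolp classical_sets functions cardinality fsbigop.

Set Implicit Arguments.
Unset Strict Implicit.
Unset Printing Implicit Defensive.

Import GRing.Theory.
Local Open Scope quotient_scope.
Local Open Scope ring_scope.

Record category := Category {
  obj :> Type;
  hom : obj -> obj -> Type;
  idm : forall X, hom X X;
  cmp : forall X Y Z, hom Y Z -> hom X Y -> hom X Z;
  cmp1m : forall X Y (u : hom X Y), cmp (idm Y) u = u;
  cmpm1 : forall X Y (u : hom X Y), cmp u (idm X) = u;
  cmpA : forall X Y Z W (w : hom Z W) (v : hom Y Z) (u : hom X Y),
    cmp w (cmp v u) = cmp (cmp w v) u }.
Arguments idm {c} X.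
Arguments cmp {c X Y Z}.

Record functor (C D : category) := Functor {
  fobj :> C -> D;
  fmap : forall X Y, hom X Y -> hom (fobj X) (fobj Y);
  fmap1 : forall X, fmap (idm X) = idm (fobj X);
  fmapM : forall X Y Z (v : hom Y Z) (u : hom X Y),
    fmap (cmp v u) = cmp (fmap v) (fmap u) }.
Arguments fmap {C D} f {X Y}.

Definition functor_id (C : category) : functor C C :=
  @Functor C C id (fun _ _ u => u) (fun _ => erefl) (fun _ _ _ _ _ => erefl).

Definition functor_comp (C D E : category)
    (G : functor D E) (F : functor C D) : functor C E.
Proof.
apply: (@Functor C E (fun X => G (F X)) (fun _ _ u => fmap G (fmap F u))).
- by move=> X; rewrite !fmap1.
- by move=> X Y Z v u; rewrite !fmapM.
Defined.

Definition is_iso (C : category) (X Y : C) (u : hom X Y) : Prop :=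
  exists v : hom Y X, cmp v u = idm X /\ cmp u v = idm Y.

Definition nat_isomorphic (C D : category) (F G : functor C D) : Prop :=
  exists eta : forall X : C, hom (F X) (G X),
    (forall X Y (u : hom X Y), cmp (eta Y) (fmap F u) = cmp (fmap G u) (eta X))
    /\ (forall X, is_iso (eta X)).

Definition is_equivalence (C D : category) (F : functor C D) : Prop :=
  exists G : functor D C,
    nat_isomorphic (functor_comp G F) (functor_id C) /\
    nat_isomorphic (functor_comp F G) (functor_id D).

Definition full_subcategory (C : category) (P : C -> Prop) : category :=
  @Category {X : C | P X} (fun X Y => hom (sval X) (sval Y))
    (fun X => idm (sval X)) (fun _ _ _ v u => cmp v u)
    (fun _ _ u => cmp1m u) (fun _ _ u => cmpm1 u)
    (fun _ _ _ _ w v u => cmpA w v u).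

Definition corestrict (C D : category) (P : D -> Prop) (F : functor C D)
    (FP : forall X, P (F X)) : functor C (full_subcategory P) :=
  @Functor C (full_subcategory P) (fun X => exist P (F X) (FP X))
    (fun _ _ u => fmap F u) (fun X => fmap1 F X) (fun _ _ _ v u => fmapM F v u).

Definition inclusion (C : category) (P : C -> Prop) :
    functor (full_subcategory P) C :=
  @Functor (full_subcategory P) C (fun X => sval X) (fun _ _ u => u)
    (fun _ => erefl) (fun _ _ _ _ _ => erefl).

(* [V] seen as an [A]-module through [phi : A -> R]. An [A]-algebra is a ring
   [R] with such a [phi], and its underlying [A]-module is [restr phi R^o];
   the algebra structures of the library exclude the zero ring. *)
Definition restr (A R : pzRingType) (phi : {rmorphism A -> R})
  (V : lmodType R) : Type := V.

Section Restr.
Variables (A R : pzRingType) (phi : {rmorphism A -> R}) (V : lmodType R).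
Local Notation W := (restr phi V).
HB.instance Definition _ := GRing.Zmodule.copy W V.
Let scale (a : A) (v : W) : W := phi a *: (v : V).
Let scaleA a b v : scale a (scale b v) = scale (a * b) v.
Proof. by rewrite /scale scalerA rmorphM. Qed.
Let scale1 : left_id 1 scale.
Proof. by move=> v; rewrite /scale rmorph1 scale1r. Qed.
Let scaleDr : right_distributive scale +%R.
Proof. by move=> a u v; rewrite /scale scalerDr. Qed.
Let scaleDl v : {morph scale^~ v : a b / a + b}.
Proof. by move=> a b; rewrite /scale rmorphD scalerDl. Qed.
HB.instance Definition _ :=
  GRing.Zmodule_isLmodule.Build A W scaleA scale1 scaleDr scaleDl.
End Restr.

Lemma restrZ (A R : pzRingType) (phi : {rmorphism A -> R}) (V : lmodType R)
  (a : A) (v : restr phi V) : a *: v = (phi a *: (v : V)) :> V.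
Proof. by []. Qed.

Record submodule (R : pzRingType) (V : lmodType R) := Submodule {
  sub_set :> V -> Prop;
  sub_set0 : sub_set 0;
  sub_setP : forall (a : R) (x y : V),
    sub_set x -> sub_set y -> sub_set (a *: x + y) }.

Definition submod_type (R : pzRingType) (V : lmodType R) (W : submodule V)
  : Type := {x : V | `[< W x >]}.

Section SubmodType.
Variables (R : pzRingType) (V : lmodType R) (W : submodule V).
Local Notation T := (submod_type W).
HB.instance Definition _ := SubChoice.copy T {x : V | `[< W x >]}.

Let inW (x : T) : W (val x).
Proof. by apply/asboolP; case: x. Qed.
Let mk (x : V) (h : W x) : T := exist _ x (asboolT h).
Let WD (x y : T) : W (val x + val y).
Proof. by rewrite -[val x]scale1r; apply: sub_setP. Qed.
Let WZ a (x : T) : W (a *: val x).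
Proof. by rewrite -[_ *: _]addr0; apply: sub_setP => //; apply: sub_set0. Qed.
Let WN (x : T) : W (- val x).
Proof. by rewrite -scaleN1r; apply: WZ. Qed.
Let zero : T := mk (sub_set0 W).
Let opp x : T := mk (WN x).
Let add x y : T := mk (WD x y).
Let scale a x : T := mk (WZ a x).
Let addA : associative add.
Proof. by move=> x y z; apply: val_inj; rewrite /= addrA. Qed.
Let addC : commutative add.
Proof. by move=> x y; apply: val_inj; rewrite /= addrC. Qed.
Let add0 : left_id zero add.
Proof. by move=> x; apply: val_inj; rewrite /= add0r. Qed.
Let addN : left_inverse zero opp add.
Proof. by move=> x; apply: val_inj; rewrite /= addNr. Qed.
HB.instance Definition _ := GRing.isZmodule.Build T addA addC add0 addN.
Let scaleA a b v : scale a (scale b v) = scale (a * b) v.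
Proof. by apply: val_inj; rewrite /= scalerA. Qed.
Let scale1 : left_id 1 scale.
Proof. by move=> v; apply: val_inj; rewrite /= scale1r. Qed.
Let scaleDr : right_distributive scale +%R.
Proof. by move=> a u v; apply: val_inj; rewrite /= scalerDr. Qed.
Let scaleDl v : {morph scale^~ v : a b / a + b}.
Proof. by move=> a b; apply: val_inj; rewrite /= scalerDl. Qed.
HB.instance Definition _ :=
  GRing.Zmodule_isLmodule.Build R T scaleA scale1 scaleDr scaleDl.

Lemma submod_typeP (x : T) : W (val x).
Proof. exact: inW. Qed.
Lemma val_submodP : linear (val : T -> V).
Proof. by []. Qed.
End SubmodType.

Lemma linear_morphD (R : pzRingType) (V W : lmodType R) (g : V -> W) :
  linear g -> {morph g : x y / x + y}.
Proof. by move=> gl x y; have := gl 1 x y; rewrite !scale1r. Qed.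

Lemma linear_morphZ (R : pzRingType) (V W : lmodType R) (g : V -> W) a x :
  linear g -> g (a *: x) = a *: g x.
Proof.
move=> gl; have g0 : g 0 = 0.
  by apply: (addrI (g 0)); rewrite addr0 -(linear_morphD gl) addr0.
by rewrite -[a *: x]addr0 gl g0 addr0.
Qed.

Definition bilinear (A : pzRingType) (M N P : lmodType A)
    (b : M -> N -> P) : Prop :=
  (forall n, linear (b^~ n)) /\ (forall m, linear (b m)).

(* [M (x)_A N] is the set of finite formal sums of pairs [(m, n)], two sums
   being identified when every bilinear map takes the same value on them; that
   is the quotient by the bilinearity relations. *)
Section Tensor.
Variables (A : comPzRingType) (M N : lmodType A).

Definition fsum (P : zmodType) (b : M -> N -> P) (s : seq (M * N)) : P :=
  \sum_(p <- s) b p.1 p.2.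

Definition tens_rel : rel (seq (M * N)) := fun s t =>
  `[< forall (P : lmodType A) (b : M -> N -> P),
        bilinear b -> fsum b s = fsum b t >].

Let tens_rel_refl : reflexive tens_rel.
Proof. by move=> s; apply/asboolP. Qed.
Let tens_rel_sym : symmetric tens_rel.
Proof. by move=> s t; apply/asboolP/asboolP => h P b bb; rewrite h. Qed.
Let tens_rel_trans : transitive tens_rel.
Proof.
move=> t s u /asboolP h1 /asboolP h2; apply/asboolP => P b bb.
by rewrite h1 // h2.
Qed.
Canonical tens_equiv :=
  EquivRel tens_rel tens_rel_refl tens_rel_sym tens_rel_trans.

Definition tensor : Type := {eq_quot tens_equiv}.
HB.instance Definition _ := Choice.copy tensor {eq_quot tens_equiv}.

Let cls (s : seq (M * N)) : tensor := \pi_({eq_quot tens_equiv}) s.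
Let rep (x : tensor) : seq (M * N) := repr (x : {eq_quot tens_equiv}).

Definition tens (m : M) (n : N) : tensor := cls [:: (m, n)].

(* The map induced by [b] on the tensor product; it is only meaningful when
   [b] is bilinear. *)
Definition tlift (P : lmodType A) (b : M -> N -> P) (x : tensor) : P :=
  fsum b (rep x).

Let tlift_cls (P : lmodType A) (b : M -> N -> P) s :
  bilinear b -> tlift b (cls s) = fsum b s.
Proof.
move=> bb.
have /eqmodP/asboolP h : rep (cls s) = s %[mod {eq_quot tens_equiv}].
  by rewrite /rep /cls reprK.
exact: h.
Qed.

Let tens_ext (x y : tensor) :
  (forall (P : lmodType A) (b : M -> N -> P), bilinear b -> tlift b x = tlift b y)
  -> x = y.
Proof.
move=> h; rewrite -[x](@reprK _ {eq_quot tens_equiv}).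
rewrite -[y](@reprK _ {eq_quot tens_equiv}).
by apply/eqmodP/asboolP => P b /h.
Qed.

Let add x y := cls (rep x ++ rep y).
Let zero := cls [::].
Let scale (a : A) x := cls [seq (a *: p.1, p.2) | p <- rep x].
Let opp x := scale (-1) x.

Let bilZl (P : lmodType A) (b : M -> N -> P) a m n :
  bilinear b -> b (a *: m) n = a *: b m n.
Proof.
move=> [bl _]; have b0 : b 0 n = 0.
  by apply: (addrI (b 0 n)); rewrite addr0 -{1}[b 0 n]scale1r -bl scaler0 addr0.
by rewrite -[a *: m]addr0 bl b0 addr0.
Qed.

Let bilZr (P : lmodType A) (b : M -> N -> P) a m n :
  bilinear b -> b m (a *: n) = a *: b m n.
Proof.
move=> [_ br]; have b0 : b m 0 = 0.
  by apply: (addrI (b m 0)); rewrite addr0 -{1}[b m 0]scale1r -br scaler0 addr0.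
by rewrite -[a *: n]addr0 br b0 addr0.
Qed.

Let tliftE0 (P : lmodType A) (b : M -> N -> P) : bilinear b ->
  (tlift b zero = 0) * (forall x y, tlift b (add x y) = tlift b x + tlift b y)
  * (forall x, tlift b (opp x) = - tlift b x)
  * (forall a x, tlift b (scale a x) = a *: tlift b x).
Proof.
move=> bb.
have liftZ a x : tlift b (scale a x) = a *: tlift b x.
  rewrite tlift_cls // /fsum big_map scaler_sumr.
  by apply: eq_bigr => p _; rewrite bilZl.
split=> //; split; last by move=> x; rewrite liftZ scaleN1r.
split=> [|x y]; rewrite tlift_cls // /fsum ?big_nil //.
by rewrite big_cat.
Qed.

Let addA : associative add.
Proof. by move=> x y z; apply: tens_ext => P b bb; rewrite !tliftE0 // addrA. Qed.
Let addC : commutative add.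
Proof. by move=> x y; apply: tens_ext => P b bb; rewrite !tliftE0 // addrC. Qed.
Let add0 : left_id zero add.
Proof. by move=> x; apply: tens_ext => P b bb; rewrite !tliftE0 // add0r. Qed.
Let addN : left_inverse zero opp add.
Proof. by move=> x; apply: tens_ext => P b bb; rewrite !tliftE0 // addNr. Qed.
HB.instance Definition _ := GRing.isZmodule.Build tensor addA addC add0 addN.
Let scaleA a b v : scale a (scale b v) = scale (a * b) v.
Proof. by apply: tens_ext => P c bb; rewrite !tliftE0 // scalerA. Qed.
Let scale1 : left_id 1 scale.
Proof. by move=> x; apply: tens_ext => P b bb; rewrite !tliftE0 // scale1r. Qed.
Let scaleDr : right_distributive scale +%R.
Proof.
move=> a x y; apply: tens_ext => P b bb.
by rewrite !tliftE0 // scalerDr.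
Qed.
Let scaleDl v : {morph scale^~ v : a b / a + b}.
Proof.
move=> a c; apply: tens_ext => P b bb.
by rewrite !tliftE0 // scalerDl.
Qed.
HB.instance Definition _ :=
  GRing.Zmodule_isLmodule.Build A tensor scaleA scale1 scaleDr scaleDl.

Lemma tlift_linear (P : lmodType A) (b : M -> N -> P) :
  bilinear b -> linear (tlift b).
Proof. by move=> bb a x y; rewrite !tliftE0. Qed.

Lemma tliftE (P : lmodType A) (b : M -> N -> P) m n :
  bilinear b -> tlift b (tens m n) = b m n.
Proof. by move=> bb; rewrite tlift_cls // /fsum big_seq1. Qed.

Lemma tens_bilinear : bilinear tens.
Proof.
split=> [n a m m'|m a n n']; apply: tens_ext => P b bb;
  by rewrite !tliftE0 // !tliftE // (bb.1, bb.2).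
Qed.

Lemma tensDl m m' n : tens (m + m') n = tens m n + tens m' n.
Proof. by have := tens_bilinear.1 n 1 m m'; rewrite !scale1r. Qed.

Lemma tensDr m n n' : tens m (n + n') = tens m n + tens m n'.
Proof. by have := tens_bilinear.2 m 1 n n'; rewrite !scale1r. Qed.

Lemma tensZl a m n : tens (a *: m) n = a *: tens m n.
Proof. by apply: tens_ext => P b bb; rewrite tliftE // !tliftE0 // tliftE // bilZl. Qed.

Lemma tensZr a m n : tens m (a *: n) = a *: tens m n.
Proof. by apply: tens_ext => P b bb; rewrite tliftE // !tliftE0 // tliftE // bilZr. Qed.

Lemma tensor_ind (Q : tensor -> Prop) :
  Q 0 -> (forall m n, Q (tens m n)) -> (forall x y, Q x -> Q y -> Q (x + y)) ->
  forall x, Q x.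
Proof.
move=> Q0 Qt QD x; rewrite -[x](@reprK _ {eq_quot tens_equiv}) -/(rep x) -/(cls _).
elim: (rep x) => [//|[m n] s IH].
suff -> : cls ((m, n) :: s) = tens m n + cls s by apply: QD.
apply: tens_ext => P b bb.
by rewrite !tliftE0 // tliftE // !tlift_cls // /fsum big_cons.
Qed.
End Tensor.

Arguments tens {A M N}.
Arguments tlift {A M N P}.

Section TensorMaps.
Variable A : comPzRingType.

Definition tmap (M M' N N' : lmodType A) (g : M -> M') (h : N -> N') :
  tensor M N -> tensor M' N' := tlift (fun m n => tens (g m) (h n)).

Definition tassoc (M N P : lmodType A) :
  tensor (tensor M N) P -> tensor M (tensor N P) :=
  tlift (fun u p => tlift (fun m n => tens m (tens n p)) u).

Lemma tmap_bilinear (M M' N N' : lmodType A) (g : M -> M') (h : N -> N') :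
  linear g -> linear h -> bilinear (fun m n => tens (g m) (h n)).
Proof.
move=> gl hl; split=> [n|m] a x y.
  by rewrite gl (tens_bilinear _ _).1.
by rewrite hl (tens_bilinear _ _).2.
Qed.

Lemma tmap_linear (M M' N N' : lmodType A) (g : M -> M') (h : N -> N') :
  linear g -> linear h -> linear (tmap g h).
Proof. by move=> gl hl; apply/tlift_linear/tmap_bilinear. Qed.

Lemma tmapE (M M' N N' : lmodType A) (g : M -> M') (h : N -> N') m n :
  linear g -> linear h -> tmap g h (tens m n) = tens (g m) (h n).
Proof. by move=> gl hl; rewrite /tmap tliftE //; apply: tmap_bilinear. Qed.

Lemma tensor_eqD (M N : lmodType A) (P : zmodType) (g h : tensor M N -> P) :
  {morph g : x y / x + y} -> {morph h : x y / x + y} ->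
  (forall m n, g (tens m n) = h (tens m n)) -> g =1 h.
Proof.
have z (k : tensor M N -> P) : {morph k : x y / x + y} -> k 0 = 0.
  by move=> kD; apply: (addrI (k 0)); rewrite addr0 -kD addr0.
move=> gD hD e; elim/tensor_ind => [|//|x y ex ey]; first by rewrite !z.
by rewrite gD hD ex ey.
Qed.

Lemma tensor_eq (M N P : lmodType A) (g h : tensor M N -> P) :
  linear g -> linear h -> (forall m n, g (tens m n) = h (tens m n)) -> g =1 h.
Proof. by move=> gl hl; apply: tensor_eqD; apply: linear_morphD. Qed.

Lemma tmap_id (M N : lmodType A) : tmap id id =1 @id (tensor M N).
Proof.
by apply: tensor_eq => // [|m n]; [apply: tmap_linear | rewrite tmapE].
Qed.

Lemma tassoc_bilinear (M N P : lmodType A) :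
  bilinear (fun (u : tensor M N) (p : P) =>
    tlift (fun m n => tens m (tens n p)) u).
Proof.
have bb (p : P) : bilinear (fun (m : M) (n : N) => tens m (tens n p)).
  split=> [n|m] a x y; first by rewrite (tens_bilinear _ _).1.
  by rewrite (tens_bilinear _ _).1 (tens_bilinear _ _).2.
split=> [p|u] a x y; first exact/tlift_linear/bb.
move: u; apply: tensor_eq => [||m n].
- exact/tlift_linear/bb.
- move=> c u v; rewrite !(tlift_linear (bb x)) !(tlift_linear (bb y)) !scalerDr !scalerA (mulrC a c).
  by rewrite addrACA.
- by rewrite !tliftE // !(tens_bilinear _ _).2.
Qed.

Lemma tassocE (M N P : lmodType A) (m : M) (n : N) (p : P) :
  tassoc (tens (tens m n) p) = tens m (tens n p).
Proof.
rewrite /tassoc tliftE; last exact: tassoc_bilinear.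
rewrite tliftE //; split=> [n'|m'] a x y.
  by rewrite (tens_bilinear _ _).1.
by rewrite (tens_bilinear _ _).1 (tens_bilinear _ _).2.
Qed.
End TensorMaps.

Definition base_change (A R : comPzRingType) (phi : {rmorphism A -> R})
  (M : lmodType A) : Type := tensor (restr phi R^o) M.

Section BaseChange.
Variables (A R : comPzRingType) (phi : {rmorphism A -> R}) (M : lmodType A).
Local Notation V := (base_change phi M).
Local Notation R' := (restr phi R^o).
HB.instance Definition _ := GRing.Zmodule.copy V (tensor R' M).

Let mul_lin (r : R) : linear (fun x : R' => (r * (x : R) : R')).
Proof.
by move=> a x y; rewrite !restrZ /= mulrDr; congr (_ + _); apply: mulrCA.
Qed.
Let scale (r : R) (v : V) : V := tmap (fun x : R' => r * (x : R) : R') id v.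
Let scale_lin r : linear (scale r : tensor R' M -> tensor R' M).
Proof. by apply: tmap_linear => //; apply: mul_lin. Qed.
Let scaleE r x m : scale r (tens (x : R') m) = tens (r * x : R') m.
Proof. by apply: tmapE => //; apply: mul_lin. Qed.
Let scaleA a b v : scale a (scale b v) = scale (a * b) v.
Proof.
move: v; apply: tensor_eq => [c x y|c x y|x m].
- by rewrite !scale_lin.
- by rewrite scale_lin.
- by rewrite !scaleE mulrA.
Qed.
Let scale1 : left_id 1 scale.
Proof.
apply: tensor_eq => [c x y|//|x m]; first by rewrite scale_lin.
by rewrite scaleE mul1r.
Qed.
Let scaleDr : right_distributive scale +%R.
Proof. by move=> a u v; have := scale_lin a 1 u v; rewrite !scale1r. Qed.
Let scaleDl v : {morph scale^~ v : a b / a + b}.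
Proof.
move=> a b; move: v; apply: tensor_eq => [c x y|c x y|x m].
- by rewrite scale_lin.
- by rewrite !scale_lin scalerDr addrACA.
rewrite !scaleE mulrDl.
by have := (tens_bilinear R' M).1 m 1 (a * (x : R)) (b * (x : R)); rewrite !scale1r.
Qed.
HB.instance Definition _ :=
  GRing.Zmodule_isLmodule.Build R V scaleA scale1 scaleDr scaleDl.

Lemma base_changeZ (r x : R) (m : M) :
  r *: (tens (x : R') m : V) = tens (r * x : R') m.
Proof. exact: scaleE. Qed.

Lemma base_changeA (a : A) (x : tensor R' M) : a *: x = phi a *: (x : V) :> V.
Proof.
move: x; apply: tensor_eq => [c x y|c x y|x m].
- by rewrite scalerDr !scalerA mulrC.
- exact: scale_lin.
- by rewrite base_changeZ -tensZl.
Qed.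

Definition to_base_change (m : M) : V := tens (1 : R') m.

Lemma to_base_change_linear : linear (to_base_change : M -> restr phi V).
Proof.
move=> a m m'; rewrite /to_base_change (tens_bilinear R' M).2; congr (_ + _).
rewrite [RHS]restrZ base_changeZ mulr1 -tensZl; congr tens.
exact: mulr1.
Qed.
End BaseChange.

Definition tensor_alg (A R R' : comPzRingType) (phi : {rmorphism A -> R})
  (phi' : {rmorphism A -> R'}) : Type := tensor (restr phi R^o) (restr phi' R'^o).

Section TensorAlg.
Variables (A R R' : comPzRingType).
Variables (phi : {rmorphism A -> R}) (phi' : {rmorphism A -> R'}).
Local Notation U := (restr phi R^o).
Local Notation U' := (restr phi' R'^o).
Local Notation T := (tensor_alg phi phi').
HB.instance Definition _ := GRing.Lmodule.copy T (tensor U U').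

Let mull (C B : comPzRingType) (psi : {rmorphism C -> B}) (r : B) :
  linear (fun x : restr psi B^o => (r * (x : B) : restr psi B^o)).
Proof.
by move=> a x y; rewrite !restrZ /= mulrDr; congr (_ + _); apply: mulrCA.
Qed.
Let mulr (C B : comPzRingType) (psi : {rmorphism C -> B}) (r : B) :
  linear (fun x : restr psi B^o => ((x : B) * r : restr psi B^o)).
Proof. by move=> a x y; rewrite !restrZ /= mulrDl -mulrA. Qed.

Definition tensor_mul (x y : T) : T :=
  tlift (fun (r : U) (r' : U') =>
    tmap (fun s : U => (r : R) * (s : R) : U)
      (fun s' : U' => (r' : R') * (s' : R') : U') y) x.

Let tmap_mul_lin (r : U) (r' : U') : linear (tmap (fun s : U => (r : R) * (s : R) : U)
      (fun s' : U' => (r' : R') * (s' : R') : U')).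
Proof. by apply: tmap_linear; apply: mull. Qed.
Let tmap_mulE (r : U) (r' : U') s s' : tmap (fun s : U => (r : R) * (s : R) : U)
      (fun s' : U' => (r' : R') * (s' : R') : U') (tens s s')
   = tens ((r : R) * s : U) ((r' : R') * s' : U').
Proof. by apply: tmapE; apply: mull. Qed.

Let mul_bil (y : T) : bilinear (fun (r : U) (r' : U') =>
    tmap (fun s : U => (r : R) * (s : R) : U)
      (fun s' : U' => (r' : R') * (s' : R') : U') y).
Proof.
split=> [r'|r] a x z; move: y; apply: tensor_eq => [c u v|c u v|s s'].
- by rewrite tmap_mul_lin.
- by rewrite !tmap_mul_lin !scalerDr !scalerA (mulrC a c) addrACA.
- by rewrite !tmap_mulE -(tens_bilinear _ _).1 mulr.
- by rewrite tmap_mul_lin.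
- by rewrite !tmap_mul_lin !scalerDr !scalerA (mulrC a c) addrACA.
- by rewrite !tmap_mulE -(tens_bilinear _ _).2 mulr.
Qed.
Let mul_linl (y : T) : linear (tensor_mul^~ y : tensor U U' -> tensor U U').
Proof. exact: (tlift_linear (mul_bil y)). Qed.

Lemma tensor_mulE (r s : R) (r' s' : R') :
  tensor_mul (tens (r : U) (r' : U')) (tens (s : U) (s' : U'))
  = tens (r * s : U) (r' * s' : U').
Proof. by rewrite /tensor_mul (tliftE _ _ (mul_bil _)) tmap_mulE. Qed.

Let mulC : commutative tensor_mul.
Proof.
have linr x : linear (tensor_mul x : tensor U U' -> tensor U U').
  move=> a y z; move: x; apply: tensor_eq => [|c u v|r r'].
  - exact: mul_linl.
  - by rewrite !mul_linl !scalerDr !scalerA (mulrC a c) addrACA.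
  - by rewrite /tensor_mul !(tliftE _ _ (mul_bil _)) tmap_mul_lin.
move=> x y; move: x; apply: tensor_eq => [||r r'].
- exact: mul_linl.
- exact: linr.
move: y; apply: tensor_eq => [||s s'].
- exact: linr.
- exact: mul_linl.
by rewrite !tensor_mulE mulrC (mulrC r').
Qed.
Let mul_linr (x : T) : linear (tensor_mul x : tensor U U' -> tensor U U').
Proof. by move=> a y z; rewrite mulC mul_linl !(mulC x). Qed.
Let mulA : associative tensor_mul.
Proof.
move=> x y z; move: x; apply: tensor_eq => [|c u v|r r'].
- exact: mul_linl.
- by rewrite !mul_linl.
move: y; apply: tensor_eq => [c u v|c u v|s s'].
- by rewrite mul_linl mul_linr.
- by rewrite mul_linr mul_linl.
move: z; apply: tensor_eq => [c u v||t t'].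
- by rewrite !mul_linr.
- exact: mul_linr.
by rewrite !tensor_mulE !mulrA.
Qed.
Let mul1 : left_id (tens (1 : U) (1 : U') : T) tensor_mul.
Proof.
apply: tensor_eq => [|//|r r']; first exact: mul_linr.
by rewrite tensor_mulE !mul1r.
Qed.
Let mulDl : left_distributive tensor_mul +%R.
Proof. by move=> x y z; have := mul_linl z 1 x y; rewrite !scale1r. Qed.
HB.instance Definition _ :=
  GRing.Zmodule_isComPzRing.Build T mulA mulC mul1 mulDl.

Lemma tensor_algM (r s : R) (r' s' : R') :
  (tens (r : U) (r' : U') : T) * (tens (s : U) (s' : U') : T)
  = tens (r * s : U) (r' * s' : U').
Proof. exact: tensor_mulE. Qed.

Lemma tensor_algZ (a : A) (x y : T) : a *: x * y = a *: (x * y).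
Proof.
rewrite -[a *: x]addr0; transitivity (a *: (x * y) + 0 * y).
  exact: mul_linl.
by rewrite mul0r addr0.
Qed.

Lemma tensor_alg1 : 1 = tens (1 : U) (1 : U') :> T.
Proof. by []. Qed.

Definition tensor_struct (a : A) : T := a *: (1 : T).
Let tensor_struct_add : zmod_morphism tensor_struct.
Proof. by move=> a b; rewrite /tensor_struct scalerBl. Qed.
Let tensor_struct_mul : monoid_morphism tensor_struct.
Proof.
split=> [|a b]; first exact: scale1r.
have E c : tensor_struct c = tens (phi c : U) (1 : U').
  rewrite -[phi c]mulr1 -[_ * _]/(c *: (1 : U)) tensZl.
  by [].
by rewrite !E tensor_algM rmorphM mulr1.
Qed.
HB.instance Definition _ :=
  GRing.isZmodMorphism.Build A T tensor_struct tensor_struct_add.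
HB.instance Definition _ :=
  GRing.isMonoidMorphism.Build A T tensor_struct tensor_struct_mul.
End TensorAlg.

Inductive term (A I : Type) :=
  | Const of A | Gen of I
  | Add of term A I & term A I | Opp of term A I | Mul of term A I & term A I.
Arguments Const {A I}.
Arguments Gen {A I}.
HB.instance Definition _ (A I : Type) := gen_eqMixin (term A I).
HB.instance Definition _ (A I : Type) := gen_choiceMixin (term A I).

Fixpoint eval (A I : Type) (R : pzRingType) (phi : A -> R) (v : I -> R)
    (t : term A I) : R :=
  match t with
  | Const a => phi a
  | Gen i => v i
  | Add t u => eval phi v t + eval phi v u
  | Opp t => - eval phi v t
  | Mul t u => eval phi v t * eval phi v u
  end.

(* The commutative [A]-algebra generated by [I] subject to the relations
   [t = u] for [(t, u)] in [E]: polynomial expressions, two of them being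
   identified when they take the same value in every commutative [A]-algebra at
   every family of elements that satisfies the relations. *)
Section Presented.
Variables (A : comPzRingType) (I : Type) (E : set (term A I * term A I)).

Definition satisfies (R : pzRingType) (phi : A -> R) (v : I -> R) : Prop :=
  forall e, E e -> eval phi v e.1 = eval phi v e.2.

Definition pres_rel : rel (term A I) := fun t u =>
  `[< forall (R : comPzRingType) (phi : {rmorphism A -> R}) (v : I -> R),
        satisfies phi v -> eval phi v t = eval phi v u >].

Let pres_rel_refl : reflexive pres_rel.
Proof. by move=> s; apply/asboolP. Qed.
Let pres_rel_sym : symmetric pres_rel.
Proof. by move=> s t; apply/asboolP/asboolP => h R phi v vE; rewrite h. Qed.
Let pres_rel_trans : transitive pres_rel.
Proof.
move=> t s u /asboolP h1 /asboolP h2; apply/asboolP => R phi v vE.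
by rewrite h1 // h2.
Qed.
Canonical pres_equiv :=
  EquivRel pres_rel pres_rel_refl pres_rel_sym pres_rel_trans.

Definition presented : Type := {eq_quot pres_equiv}.
HB.instance Definition _ := Choice.copy presented {eq_quot pres_equiv}.

Let cls (t : term A I) : presented := \pi_({eq_quot pres_equiv}) t.
Let rep (x : presented) : term A I := repr (x : {eq_quot pres_equiv}).

Definition pres_const (a : A) : presented := cls (Const a).
Definition pres_gen (i : I) : presented := cls (Gen i).

Definition pres_lift (R : comPzRingType) (phi : {rmorphism A -> R})
  (v : I -> R) (vE : satisfies phi v) (x : presented) : R := eval phi v (rep x).

Let pres_lift_cls (R : comPzRingType) (phi : {rmorphism A -> R})
  (v : I -> R) (vE : satisfies phi v) t : pres_lift vE (cls t) = eval phi v t.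
Proof.
have /eqmodP/asboolP h : rep (cls t) = t %[mod {eq_quot pres_equiv}].
  by rewrite /rep /cls reprK.
exact: h.
Qed.

Lemma pres_ext (x y : presented) :
  (forall (R : comPzRingType) (phi : {rmorphism A -> R}) (v : I -> R)
     (vE : satisfies phi v), pres_lift vE x = pres_lift vE y) -> x = y.
Proof.
move=> h; rewrite -[x](@reprK _ {eq_quot pres_equiv}).
rewrite -[y](@reprK _ {eq_quot pres_equiv}).
by apply/eqmodP/asboolP => R phi v vE; apply: (h R phi v vE).
Qed.

Let zero := pres_const 0.
Let one := pres_const 1.
Let add x y := cls (Add (rep x) (rep y)).
Let opp x := cls (Opp (rep x)).
Let mul x y := cls (Mul (rep x) (rep y)).

Let liftE0 (R : comPzRingType) (phi : {rmorphism A -> R})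
    (v : I -> R) (vE : satisfies phi v) :
  (forall a, pres_lift vE (pres_const a) = phi a)
  * (forall x y, pres_lift vE (add x y) = pres_lift vE x + pres_lift vE y)
  * (forall x, pres_lift vE (opp x) = - pres_lift vE x)
  * (forall x y, pres_lift vE (mul x y) = pres_lift vE x * pres_lift vE y).
Proof. by do !split=> *; rewrite pres_lift_cls. Qed.

Let addA : associative add.
Proof. by move=> x y z; apply: pres_ext => *; rewrite !liftE0 addrA. Qed.
Let addC : commutative add.
Proof. by move=> x y; apply: pres_ext => *; rewrite !liftE0 addrC. Qed.
Let add0 : left_id zero add.
Proof. by move=> x; apply: pres_ext => *; rewrite !liftE0 rmorph0 add0r. Qed.
Let addN : left_inverse zero opp add.
Proof. by move=> x; apply: pres_ext => *; rewrite !liftE0 rmorph0 addNr. Qed.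
HB.instance Definition _ := GRing.isZmodule.Build presented addA addC add0 addN.
Let mulA : associative mul.
Proof. by move=> x y z; apply: pres_ext => *; rewrite !liftE0 mulrA. Qed.
Let mulC : commutative mul.
Proof. by move=> x y; apply: pres_ext => *; rewrite !liftE0 mulrC. Qed.
Let mul1 : left_id one mul.
Proof. by move=> x; apply: pres_ext => *; rewrite !liftE0 rmorph1 mul1r. Qed.
Let mulDl : left_distributive mul add.
Proof. by move=> x y z; apply: pres_ext => *; rewrite !liftE0 mulrDl. Qed.
HB.instance Definition _ :=
  GRing.Zmodule_isComPzRing.Build presented mulA mulC mul1 mulDl.

Let pres_const_add : zmod_morphism pres_const.
Proof. by move=> a b; apply: pres_ext => *; rewrite !liftE0 rmorphB. Qed.
Let pres_const_mul : monoid_morphism pres_const.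
Proof. by split=> // a b; apply: pres_ext => *; rewrite !liftE0 rmorphM. Qed.
HB.instance Definition _ :=
  GRing.isZmodMorphism.Build A presented pres_const pres_const_add.
HB.instance Definition _ :=
  GRing.isMonoidMorphism.Build A presented pres_const pres_const_mul.

Section PresLift.
Variables (R : comPzRingType) (phi : {rmorphism A -> R}) (v : I -> R).
Variable vE : satisfies phi v.
Let pres_lift_add : zmod_morphism (pres_lift vE).
Proof. by move=> x y; rewrite !liftE0. Qed.
Let pres_lift_mul : monoid_morphism (pres_lift vE).
Proof. by split=> [|x y]; rewrite liftE0 ?rmorph1. Qed.
HB.instance Definition _ :=
  GRing.isZmodMorphism.Build presented R (pres_lift vE) pres_lift_add.
HB.instance Definition _ :=
  GRing.isMonoidMorphism.Build presented R (pres_lift vE) pres_lift_mul.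

Lemma pres_lift_const a : pres_lift vE (pres_const a) = phi a.
Proof. by rewrite liftE0. Qed.
Lemma pres_lift_gen i : pres_lift vE (pres_gen i) = v i.
Proof. exact: pres_lift_cls. Qed.
End PresLift.

Let eval_cls t : eval pres_const pres_gen t = cls t.
Proof.
elim: t => [//|//|t IHt u IHu|t IHt|t IHt u IHu] /=; rewrite ?IHt ?IHu;
  by apply: pres_ext => *; rewrite liftE0 !pres_lift_cls.
Qed.

Lemma pres_gen_satisfies : satisfies pres_const pres_gen.
Proof.
move=> e Ee; rewrite !eval_cls; apply: pres_ext => R phi v vE.
by rewrite !pres_lift_cls vE.
Qed.

Lemma pres_ind (Q : presented -> Prop) :
  (forall a, Q (pres_const a)) -> (forall i, Q (pres_gen i)) ->
  (forall x y, Q x -> Q y -> Q (x + y)) -> (forall x, Q x -> Q (- x)) ->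
  (forall x y, Q x -> Q y -> Q (x * y)) -> forall x, Q x.
Proof.
move=> Qc Qg QD QN QM x; rewrite -[x](@reprK _ {eq_quot pres_equiv}).
rewrite -/(rep x) -/(cls _) -eval_cls.
by elim: (rep x) => /=; auto.
Qed.
End Presented.

(* [a / f ^ n] is represented by [(a, n)]. *)
Section Localization.
Variables (A : comPzRingType) (f : A).

Definition loc_rel : rel (A * nat) := fun x y =>
  `[< exists k : nat, f ^+ (k + y.2) * x.1 = f ^+ (k + x.2) * y.1 >].

Let loc_rel_refl : reflexive loc_rel.
Proof. by move=> x; apply/asboolP; exists 0%N. Qed.
Let loc_rel_sym : symmetric loc_rel.
Proof. by move=> x y; apply/asboolP/asboolP => -[k h]; exists k. Qed.
Let loc_rel_trans : transitive loc_rel.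
Proof.
move=> [b m] [a n] [c p] /asboolP[k /= h1] /asboolP[l /= h2].
apply/asboolP; exists (k + l + m)%N => /=.
transitivity (f ^+ (l + p) * (f ^+ (k + m) * a)).
  by rewrite mulrA -exprD; congr (f ^+ _ * _); rewrite -!addnA; do !nat_congr.
rewrite h1 mulrCA h2 mulrA -exprD; congr (f ^+ _ * _).
by rewrite -!addnA; do !nat_congr.
Qed.
Canonical loc_equiv :=
  EquivRel loc_rel loc_rel_refl loc_rel_sym loc_rel_trans.

Definition loc : Type := {eq_quot loc_equiv}.
HB.instance Definition _ := Choice.copy loc {eq_quot loc_equiv}.

Definition frac (a : A) (n : nat) : loc := \pi_({eq_quot loc_equiv}) (a, n).
Let rep (x : loc) : A * nat := repr (x : {eq_quot loc_equiv}).

Lemma frac_eq a n b m :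
  frac a n = frac b m <->
  exists k : nat, f ^+ (k + m) * a = f ^+ (k + n) * b.
Proof.
split; first by move/(@eqmodP _ loc_equiv)/asboolP.
by move=> h; apply/(@eqmodP _ loc_equiv)/asboolP.
Qed.

Lemma frac_ind (Q : loc -> Prop) : (forall a n, Q (frac a n)) -> forall x, Q x.
Proof.
move=> h x; rewrite -[x](@reprK _ {eq_quot loc_equiv}).
by case: (repr _) => a n; apply: h.
Qed.

Let zero := frac 0 0.
Let one := frac 1 0.
Let add x y := let: (a, n) := rep x in let: (b, m) := rep y in
  frac (f ^+ m * a + f ^+ n * b) (n + m).
Let opp x := let: (a, n) := rep x in frac (- a) n.
Let mul x y := let: (a, n) := rep x in let: (b, m) := rep y in
  frac (a * b) (n + m).

Let repP a n : exists k : nat,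
  f ^+ (k + n) * (rep (frac a n)).1 = f ^+ (k + (rep (frac a n)).2) * a.
Proof.
have /frac_eq : frac (rep (frac a n)).1 (rep (frac a n)).2 = frac a n.
  by rewrite /frac -surjective_pairing reprK.
by [].
Qed.

Let addE a n b m : add (frac a n) (frac b m)
  = frac (f ^+ m * a + f ^+ n * b) (n + m).
Proof.
rewrite /add; have := repP a n; case: (rep _) => a' n' /= [k h].
have := repP b m; case: (rep _) => b' m' /= [l h'].
apply/frac_eq; exists (k + l)%N; move: h h'; rewrite !exprD => h h'.
rewrite !mulrDr.
transitivity (f ^+ l * f ^+ m * f ^+ m' * (f ^+ k * f ^+ n * a')
   + f ^+ k * f ^+ n * f ^+ n' * (f ^+ l * f ^+ m * b')); first by ring.
by rewrite h h'; ring.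
Qed.
Let mulE a n b m : mul (frac a n) (frac b m) = frac (a * b) (n + m).
Proof.
rewrite /mul; have := repP a n; case: (rep _) => a' n' /= [k h].
have := repP b m; case: (rep _) => b' m' /= [l h'].
apply/frac_eq; exists (k + l)%N; move: h h'; rewrite !exprD => h h'.
transitivity ((f ^+ k * f ^+ n * a') * (f ^+ l * f ^+ m * b')); first by ring.
by rewrite h h'; ring.
Qed.
Let oppE a n : opp (frac a n) = frac (- a) n.
Proof.
rewrite /opp; have := repP a n; case: (rep _) => a' n' /= [k h].
by apply/frac_eq; exists k; rewrite !mulrN h.
Qed.

Let addA : associative add.
Proof.
elim/frac_ind=> a n; elim/frac_ind=> b m; elim/frac_ind=> c p.
by rewrite !addE addnA; congr frac; rewrite !exprD; ring.
Qed.
Let addC : commutative add.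
Proof.
by elim/frac_ind=> a n; elim/frac_ind=> b m; rewrite !addE addnC addrC.
Qed.
Let add0 : left_id zero add.
Proof.
by elim/frac_ind=> a n; rewrite addE; congr frac; rewrite mulr0 add0r mul1r.
Qed.
Let addN : left_inverse zero opp add.
Proof.
elim/frac_ind=> a n; rewrite oppE addE; apply/frac_eq; exists 0%N.
by rewrite mulrN addNr !mulr0.
Qed.
HB.instance Definition _ := GRing.isZmodule.Build loc addA addC add0 addN.
Let mulA : associative mul.
Proof.
elim/frac_ind=> a n; elim/frac_ind=> b m; elim/frac_ind=> c p.
by rewrite !mulE addnA mulrA.
Qed.
Let mulC : commutative mul.
Proof.
by elim/frac_ind=> a n; elim/frac_ind=> b m; rewrite !mulE addnC mulrC.
Qed.
Let mul1 : left_id one mul.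
Proof. by elim/frac_ind=> a n; rewrite mulE mul1r. Qed.
Let mulDl : left_distributive mul add.
Proof.
elim/frac_ind=> a n; elim/frac_ind=> b m; elim/frac_ind=> c p.
rewrite addE !mulE addE; apply/frac_eq; exists 0%N.
by rewrite !exprD; ring.
Qed.
HB.instance Definition _ :=
  GRing.Zmodule_isComPzRing.Build loc mulA mulC mul1 mulDl.

Lemma fracD a n b m :
  frac a n + frac b m = frac (f ^+ m * a + f ^+ n * b) (n + m).
Proof. exact: addE. Qed.
Lemma fracN a n : - frac a n = frac (- a) n.
Proof. exact: oppE. Qed.
Lemma fracM a n b m : frac a n * frac b m = frac (a * b) (n + m).
Proof. exact: mulE. Qed.

Definition loc_const (a : A) : loc := frac a 0.
Let loc_const_add : zmod_morphism loc_const.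
Proof. by move=> a b; rewrite /loc_const fracN fracD !mul1r. Qed.
Let loc_const_mul : monoid_morphism loc_const.
Proof. by split=> // a b; rewrite /loc_const fracM. Qed.
HB.instance Definition _ :=
  GRing.isZmodMorphism.Build A loc loc_const loc_const_add.
HB.instance Definition _ :=
  GRing.isMonoidMorphism.Build A loc loc_const loc_const_mul.

Lemma frac_inv : loc_const f * frac 1 1 = 1.
Proof. by rewrite fracM; apply/frac_eq; exists 0%N; rewrite !mulr1 !mul1r. Qed.
End Localization.

Section Comodules.
Variables (A : comPzRingType) (C : lmodType A).
Variables (Delta : C -> tensor C C) (eps : C -> A).

Record comodule := Comodule {
  cmod :> lmodType A;
  coact : cmod -> tensor C cmod;
  coact_linear : linear coact;
  coactA : forall m,
    tassoc (tmap Delta id (coact m)) = tmap id coact (coact m);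
  coact1 : forall m, tlift (fun s m' => eps s *: m') (coact m) = m }.

Record comodule_hom (M M' : comodule) := ComoduleHom {
  chom :> M -> M';
  chom_linear : linear chom;
  chom_coact : forall m, coact (chom m) = tmap id chom (coact m) }.

Lemma comodule_hom_eq (M M' : comodule) (u v : comodule_hom M M') :
  u =1 v -> u = v.
Proof.
case: u v => [u ul uc] [v vl vc] /= /funext uv; subst v.
by rewrite (Prop_irrelevance vl ul) (Prop_irrelevance vc uc).
Qed.

Lemma coact_id (M : comodule) (m : M) : coact m = tmap id id (coact m).
Proof. by rewrite tmap_id. Qed.

Definition comodule_id (M : comodule) : comodule_hom M M :=
  @ComoduleHom M M id (fun _ _ _ => erefl) (@coact_id M).

Section Comp.
Variables (M1 M2 M3 : comodule).
Variables (v : comodule_hom M2 M3) (u : comodule_hom M1 M2).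
Lemma comp_linear : linear (fun m => v (u m)).
Proof. by move=> a x y; rewrite chom_linear chom_linear. Qed.

Lemma comp_coact m : coact (v (u m)) = tmap id (fun m => v (u m)) (coact m).
Proof.
rewrite !chom_coact; move: (coact m).
have ul := chom_linear u; have vl := chom_linear v; have vul := comp_linear.
apply: tensor_eq => [a x y||s m']; last by rewrite !tmapE.
  by rewrite (tmap_linear _ ul) // (tmap_linear _ vl).
by apply: tmap_linear.
Qed.

Definition comodule_comp : comodule_hom M1 M3 := ComoduleHom comp_linear comp_coact.
End Comp.

Definition comodule_category : category.
Proof.
apply: (@Category comodule comodule_hom comodule_id comodule_comp).
- by move=> X Y u; apply: comodule_hom_eq => m.
- by move=> X Y u; apply: comodule_hom_eq => m.
- by move=> X Y Z W w v u; apply: comodule_hom_eq => m.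
Defined.
End Comodules.

Inductive G_gens := GT | GTinv | GX.

Section GroupScheme.
Variables (A : comPzRingType) (f : A).

Definition G_rels : set (term A G_gens * term A G_gens) :=
  [set (Mul (Gen GT) (Gen GTinv), Const 1);
       (Add (Gen GT) (Opp (Const 1)), Mul (Const f) (Gen GX))].

(* [S = A[T, T^-1, X] / (T - 1 - f X)] *)
Definition G_alg : comPzRingType := presented G_rels.
Definition G_struct : {rmorphism A -> G_alg} := @pres_const _ _ G_rels.
Definition sT : G_alg := pres_gen G_rels GT.
Definition sTinv : G_alg := pres_gen G_rels GTinv.
Definition sX : G_alg := pres_gen G_rels GX.
Definition G_mod : lmodType A := restr G_struct G_alg^o.

(* For an [A]-algebra [R], the triples [(t, t^-1, x)] with [(t, x)] in [G(R)]. *)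
Definition G_point (R : comPzRingType) (phi : {rmorphism A -> R})
    (t t' x : R) : Prop := t * t' = 1 /\ t - 1 = phi f * x.

Definition G_val (R : Type) (t t' x : R) (i : G_gens) : R :=
  match i with GT => t | GTinv => t' | GX => x end.

Lemma G_pointP (R : comPzRingType) (phi : {rmorphism A -> R}) (t t' x : R) :
  G_point phi t t' x -> satisfies G_rels phi (G_val t t' x).
Proof. by case=> h1 h2 e [] -> /=; rewrite rmorph1. Qed.

Lemma G_point_gen : G_point G_struct sT sTinv sX.
Proof.
have h := @pres_gen_satisfies _ _ G_rels; split.
  by have /= -> := h _ (or_introl erefl); rewrite -[LHS](rmorph1 G_struct).
by have /= := h _ (or_intror erefl); rewrite -(rmorph1 G_struct).
Qed.

Definition G_eval (R : comPzRingType) (phi : {rmorphism A -> R}) (t t' x : R)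
    (h : G_point phi t t' x) : {rmorphism G_alg -> R} :=
  pres_lift (G_pointP h).

Lemma G_point_one : G_point (idfun : {rmorphism A -> A}) 1 1 0.
Proof. by split; rewrite ?mulr1 // mulr0 subrr. Qed.

Definition G_eps : {rmorphism G_alg -> A} := G_eval G_point_one.

Definition SS : comPzRingType := tensor_alg G_struct G_struct.
Definition pure (s s' : G_alg) : SS :=
  tens (s : restr G_struct G_alg^o) (s' : restr G_struct G_alg^o).

(* [pure sT 1, pure sX 1] and [pure 1 sT, pure 1 sX] are the two canonical points
   of [G(S (x) S)]; this is their product. *)
Lemma G_point_mul :
  G_point (@tensor_struct _ _ _ G_struct G_struct)
    (pure sT sT) (pure sTinv sTinv)
    (pure sX 1 + pure 1 sX + f *: pure sX sX).
Proof.
have [hT hX] := G_point_gen.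
have M r s r' s' : pure r s * pure r' s' = pure (r * r') (s * s').
  exact: tensor_algM.
split; first by rewrite M hT.
set F := (X in _ = X * _).
have FZ (x : SS) : f *: x = F * x by rewrite tensor_algZ mul1r.
have fX : f *: (sX : G_mod) = sT - 1 :> G_alg by rewrite hX.
have T1 : pure sT 1 = 1 + F * pure sX 1.
  rewrite -FZ; transitivity (pure (1 + f *: (sX : G_mod)) 1).
    by congr tens; rewrite fX addrC subrK.
  exact: etrans (tensDl _ _ _) (congr1 _ (tensZl _ _ _)).
have T2 : pure 1 sT = 1 + F * pure 1 sX.
  rewrite -FZ; transitivity (pure 1 (1 + f *: (sX : G_mod))).
    by congr tens; rewrite fX addrC subrK.
  exact: etrans (tensDr _ _ _) (congr1 _ (tensZr _ _ _)).
have -> : pure sT sT = pure sT 1 * pure 1 sT by rewrite M mulr1 mul1r.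
have -> : pure sX sX = pure sX 1 * pure 1 sX by rewrite M mulr1 mul1r.
by rewrite T1 T2 FZ; ring.
Qed.

Definition G_Delta : {rmorphism G_alg -> SS} := G_eval G_point_mul.

Definition RepG : category :=
  comodule_category (G_Delta : G_mod -> tensor G_mod G_mod) G_eps.

Definition RepG_f : category :=
  full_subcategory (fun M : RepG =>
    injective (fun m : cmod M => f *: m)).
End GroupScheme.

Inductive laurent_gens := LT | LTinv.

Section Laurent.
Variable B : comPzRingType.

Definition laurent : comPzRingType :=
  presented ([set (Mul (Gen LT) (Gen LTinv), Const 1)]
    : set (term B laurent_gens * term B laurent_gens)).
Definition laurent_struct : {rmorphism B -> laurent} :=
  @pres_const _ _ [set (Mul (Gen LT) (Gen LTinv), Const 1)].
Definition laurent_mod : lmodType B := restr laurent_struct laurent^o.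

Definition lT : laurent := pres_gen _ LT.
Definition lTinv : laurent := pres_gen _ LTinv.
Definition lTz (i : int) : laurent :=
  match i with Posz n => lT ^+ n | Negz n => lTinv ^+ n.+1 end.

Lemma lT_mul : lT * lTinv = 1.
Proof.
have h := @pres_gen_satisfies B _ [set (Mul (Gen LT) (Gen LTinv), Const 1)].
by have /= -> := h _ erefl; rewrite -[LHS](rmorph1 laurent_struct).
Qed.
End Laurent.

Section Gradings.
Variables (B : comPzRingType) (N : lmodType B) (gr : int -> submodule N).

Definition is_decomposition (x : N) (c : int -> N) : Prop :=
  [/\ finite_set [set i | c i != 0], forall i, gr i (c i)
    & x = \sum_(i \in [set: int]) c i].

(* [N] is the internal direct sum of the [gr i]. *)
Definition is_grading : Prop :=
  forall x : N, exists! c : int -> N, is_decomposition x c.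

Definition component (x : N) : int -> N := xget (fun=> 0) (is_decomposition x).
End Gradings.

(* [i (i - 1) ... (i - n + 1) / n!]; the division is exact. *)
Definition binz (i : int) (n : nat) : int :=
  ((\prod_(k < n) (i - k%:Z)) %/ (n`!)%:Z)%Z.

Section Pairs.
Variables (A : comPzRingType) (f : A).
Local Notation B := (loc f).
Local Notation iota := (loc_const f : {rmorphism A -> B}).

(* The data of a pair [(N, M)]; the conditions on it are in [in_C] below. *)
Record gpair := GPair {
  pN : lmodType B;
  pgr : int -> submodule pN;
  pM : submodule (restr iota pN) }.

Record gpair_hom (X Y : gpair) := GPairHom {
  phom :> pN X -> pN Y;
  phom_linear : linear phom;
  phom_graded : forall i x, pgr X i x -> pgr Y i (phom x);
  phom_lattice : forall x, pM X x -> pM Y (phom x) }.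

Lemma gpair_hom_eq (X Y : gpair) (u v : gpair_hom X Y) : u =1 v -> u = v.
Proof.
case: u v => [u u1 u2 u3] [v v1 v2 v3] /= /funext uv; subst v.
by congr GPairHom; apply: Prop_irrelevance.
Qed.

Definition gpair_id (X : gpair) : gpair_hom X X :=
  @GPairHom X X id (fun _ _ _ => erefl) (fun _ _ h => h) (fun _ h => h).

Lemma gpair_comp_linear (X Y Z : gpair) (v : gpair_hom Y Z) (u : gpair_hom X Y) :
  linear (fun x => v (u x)).
Proof. by move=> a x y; rewrite !phom_linear. Qed.

Definition gpair_comp (X Y Z : gpair) (v : gpair_hom Y Z) (u : gpair_hom X Y) :
    gpair_hom X Z :=
  @GPairHom X Z (fun x => v (u x)) (gpair_comp_linear v u)
    (fun i x h => phom_graded v (phom_graded u h))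
    (fun x h => phom_lattice v (phom_lattice u h)).

Definition gpair_category : category.
Proof.
apply: (@Category gpair gpair_hom gpair_id gpair_comp).
- by move=> X Y u; apply: gpair_hom_eq => x.
- by move=> X Y u; apply: gpair_hom_eq => x.
- by move=> X Y Z W w v u; apply: gpair_hom_eq => x.
Defined.

(* The natural map [B (x)_A M -> N], [b (x) m |-> b m]. *)
Definition gpair_map (X : gpair) : base_change iota (submod_type (pM X)) -> pN X :=
  tlift (fun (b : restr iota B^o) (m : submod_type (pM X)) =>
    ((b : B) *: (val m : pN X) : restr iota (pN X))).

Definition gpair_C (X : gpair) (n : nat) (x : pN X) : pN X :=
  \sum_(i \in [set: int])
    (iota f ^+ n * (binz i n)%:~R) *: component (pgr X) x i.

Definition in_C (X : gpair) : Prop :=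
  [/\ is_grading (pgr X), bijective (gpair_map (X := X))
    & forall n x, pM X x -> pM X (gpair_C n x)].

Definition catC : category := full_subcategory (C := gpair_category) in_C.

Local Notation L := (laurent B).

Lemma lambda_point :
  G_point f (@laurent_struct B \o iota) (lT B) (lTinv B)
    (laurent_struct B (frac f 1 1) * (lT B - 1)).
Proof.
split; first exact: lT_mul.
by rewrite /= mulrA -rmorphM frac_inv rmorph1 mul1r.
Qed.

(* [S -> B[T, T^-1]], [T |-> T], [X |-> f^-1 (T - 1)]; it induces the isomorphism
   [B (x)_A S ~ B[T, T^-1]]. *)
Definition lambda : {rmorphism G_alg f -> L} := G_eval lambda_point.

Lemma lambdaZ (a : A) (s : G_mod f) :
  lambda (a *: s) = iota a *: (lambda s : laurent_mod B) :> laurent_mod B.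
Proof.
transitivity (lambda (G_struct f a) * lambda s).
  exact: (rmorphM lambda (G_struct f a) s).
by congr (_ * _); apply: pres_lift_const.
Qed.

Section OnObjects.
Variable M : RepG f.
Local Notation N := (base_change iota (cmod M)).

(* [s (x) m |-> lambda s (x) (1 (x) m)] *)
Definition F_coact0 : tensor (G_mod f) (cmod M)
    -> restr iota (tensor (laurent_mod B) N) :=
  tlift (fun (s : G_mod f) (m : cmod M) =>
    (tens (lambda s : laurent_mod B) (to_base_change iota m)
      : restr iota (tensor (laurent_mod B) N))).

(* The comultiplication [N -> B[T, T^-1] (x)_B N] obtained from that of [M] by
   extension of scalars. *)
Definition F_coact : N -> tensor (laurent_mod B) N :=
  tlift (fun (b : restr iota B^o) (m : cmod M) =>
    ((b : B) *: (F_coact0 (coact m) : tensor (laurent_mod B) N)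
      : restr iota (tensor (laurent_mod B) N))).

Lemma F_coact0_bilinear : bilinear (fun (s : G_mod f) (m : cmod M) =>
    (tens (lambda s : laurent_mod B) (to_base_change iota m)
      : restr iota (tensor (laurent_mod B) N))).
Proof.
split=> [m|s] a x y.
  transitivity (tens (iota a *: (lambda x : laurent_mod B) + lambda y) (to_base_change iota m)).
    congr tens; rewrite -lambdaZ; exact: (rmorphD lambda).
  exact: etrans (tensDl _ _ _) (congr1 (+%R^~ _) (tensZl _ _ _)).
transitivity (tens (lambda s : laurent_mod B)
  (iota a *: to_base_change iota x + to_base_change iota y)).
  congr tens; exact: to_base_change_linear.
exact: etrans (tensDr _ _ _) (congr1 (+%R^~ _) (tensZr _ _ _)).
Qed.

Lemma F_coact_bilinear : bilinear (fun (b : restr iota B^o) (m : cmod M) =>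
    ((b : B) *: (F_coact0 (coact m) : tensor (laurent_mod B) N)
      : restr iota (tensor (laurent_mod B) N))).
Proof.
pose V : lmodType B := tensor (laurent_mod B) N.
split=> [m|b] a x y.
  set v : V := F_coact0 _.
  exact: etrans (scalerDl v (iota a * x) y) (congr1 (+%R^~ _) (esym (scalerA _ _ _))).
have -> : F_coact0 (coact (a *: x + y))
    = iota a *: (F_coact0 (coact x) : V) + (F_coact0 (coact y) : V).
  by rewrite coact_linear; apply: (tlift_linear F_coact0_bilinear).
set u : V := F_coact0 _; set v : V := F_coact0 _.
transitivity (iota a *: (b *: u) + b *: v); last by [].
by rewrite (scalerDr (b : B)) !scalerA (mulrC (b : B)).
Qed.

Lemma F_coact_tens (b : B) (m : cmod M) :
  F_coact (tens (b : restr iota B^o) m) = b *: F_coact0 (coact m).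
Proof. exact: tliftE F_coact_bilinear. Qed.

Lemma F_coact_linear : linear F_coact.
Proof.
have FA := tlift_linear F_coact_bilinear.
have FD x y : F_coact (x + y) = F_coact x + F_coact y.
  exact: (linear_morphD FA).
suff FZ b x : F_coact (b *: x) = b *: F_coact x.
  by move=> b x y; rewrite FD FZ.
move: x; apply: (@tensor_eqD _ _ _ _ (fun x : N => F_coact (b *: x))
    (fun x : N => b *: F_coact x)) => [x y|x y|c m].
- by rewrite (scalerDr b (x : N) y) FD.
- by rewrite -scalerDr -FD.
- by rewrite base_changeZ !F_coact_tens scalerA.
Qed.

(* [N_i = {x | F_coact x = T^i (x) x}]: the grading is the one for which
   [F_coact (\sum_i x_i) = \sum_i T^i (x) x_i]. *)
Lemma F_gr0 i : F_coact 0 = tens (lTz B i : laurent_mod B) (0 : N).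
Proof.
rewrite -[X in tens _ X](scale0r (0 : N)) tensZr scale0r.
by have := linear_morphZ 0 0 F_coact_linear; rewrite !scale0r.
Qed.

Lemma F_grP i (b : B) (x y : N) :
  F_coact x = tens (lTz B i : laurent_mod B) x ->
  F_coact y = tens (lTz B i : laurent_mod B) y ->
  F_coact (b *: x + y) = tens (lTz B i : laurent_mod B) (b *: x + y).
Proof. by move=> hx hy; rewrite F_coact_linear hx hy tensDr tensZr. Qed.

Definition F_gr (i : int) : submodule N :=
  @Submodule B N (fun x => F_coact x = tens (lTz B i : laurent_mod B) x)
    (F_gr0 i) (@F_grP i).

Lemma F_lattice0 : exists m : cmod M, (0 : restr iota N) = to_base_change iota m.
Proof.
exists 0; have := @to_base_change_linear _ _ iota (cmod M) (-1) 0 0.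
by rewrite scaler0 addr0 scaleN1r addNr.
Qed.

Lemma F_latticeP (a : A) (x y : restr iota N) :
  (exists m : cmod M, x = to_base_change iota m) ->
  (exists m : cmod M, y = to_base_change iota m) ->
  exists m : cmod M, a *: x + y = to_base_change iota m.
Proof.
move=> [m ->] [m' ->]; exists (a *: m + m').
exact/esym/to_base_change_linear.
Qed.

Definition F_lattice : submodule (restr iota N) :=
  @Submodule A (restr iota N) (fun x => exists m : cmod M, x = to_base_change iota m)
    F_lattice0 F_latticeP.

Definition F_obj : gpair := @GPair N F_gr F_lattice.
End OnObjects.

Section OnMorphisms.
Variables (M M' : RepG f) (g : hom M M').
Local Notation N := (base_change iota (cmod M)).
Local Notation N' := (base_change iota (cmod M')).

Definition F_map : N -> N' := tmap id (chom g).

Lemma F_map_tens (b : B) (m : cmod M) :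
  F_map (tens (b : restr iota B^o) m) = tens (b : restr iota B^o) (chom g m).
Proof. by apply: tmapE => //; apply: chom_linear. Qed.

Lemma F_map_linear : linear F_map.
Proof.
have FA : linear (F_map : tensor (restr iota B^o) (cmod M) -> _).
  by apply: tmap_linear => //; apply: chom_linear.
have FD x y : F_map (x + y) = F_map x + F_map y by exact: (linear_morphD FA).
suff FZ b x : F_map (b *: x) = b *: F_map x by move=> b x y; rewrite FD FZ.
move: x; apply: (@tensor_eqD _ _ _ _ (fun x : N => F_map (b *: x))
    (fun x : N => b *: F_map x)) => [x y|x y|c m].
- by rewrite (scalerDr b (x : N) y) FD.
- by rewrite -scalerDr -FD.
- by rewrite F_map_tens !base_changeZ F_map_tens.
Qed.

Lemma F_map_coact (x : N) : F_coact (F_map x) = tmap id F_map (F_coact x).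
Proof.
have gl := chom_linear g.
have Fl := F_map_linear; have FD := linear_morphD Fl.
have cD := linear_morphD (@F_coact_linear M).
have cD' := linear_morphD (@F_coact_linear M').
have tl : linear (tmap (M := laurent_mod B) id F_map) by apply: tmap_linear.
have tD := linear_morphD tl.
have hD := linear_morphD (tlift_linear (@F_coact0_bilinear M)).
have hD' := linear_morphD (tlift_linear (@F_coact0_bilinear M')).
have sD := linear_morphD (@tmap_linear _ (G_mod f) (G_mod f) _ _ id (chom g) (fun _ _ _ => erefl) gl).
move: x; apply: (@tensor_eqD _ _ _ _ (fun x : N => F_coact (F_map x))
    (fun x : N => tmap id F_map (F_coact x))) => [x y|x y|b m].
- by rewrite FD cD'.
- by rewrite cD tD.
rewrite F_map_tens !F_coact_tens (chom_coact g).
transitivity (b *: tmap id F_map (F_coact0 (coact m))); last first.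
  by rewrite (linear_morphZ _ _ tl).
congr (_ *: _); move: (coact m).
apply: (@tensor_eqD _ _ _ _ (fun u => F_coact0 (tmap id (chom g) u))
    (fun u => tmap id F_map (F_coact0 u : tensor (laurent_mod B) N))) => [u v|u v|s n].
- by rewrite sD; apply: hD'.
- by rewrite -tD; congr tmap; apply: hD.
rewrite tmapE // /F_coact0 !tliftE; try exact: F_coact0_bilinear.
by rewrite tmapE // F_map_tens.
Qed.

Lemma F_map_graded i x : F_gr M i x -> F_gr M' i (F_map x).
Proof.
rewrite /= F_map_coact => ->; rewrite tmapE //; exact: F_map_linear.
Qed.

Lemma F_map_lattice x : F_lattice M x -> F_lattice M' (F_map x).
Proof. by case=> m ->; exists (chom g m); apply: F_map_tens. Qed.

Definition F_hom : hom (F_obj M : gpair_category) (F_obj M') :=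
  @GPairHom (F_obj M) (F_obj M') F_map F_map_linear F_map_graded F_map_lattice.
End OnMorphisms.

(* [M |-> (B (x)_A M, image of M)], into all pairs. *)
Definition F_pair : functor (RepG f) gpair_category.
Proof.
apply: (@Functor (RepG f) gpair_category F_obj F_hom).
- by move=> M; apply: gpair_hom_eq => x; apply: tmap_id.
- move=> M1 M2 M3 v u; apply: gpair_hom_eq.
  have FD (X Y : RepG f) (w : hom X Y) := linear_morphD (F_map_linear w).
  apply: tensor_eqD => [x y|x y|b m]; first exact: FD.
    by rewrite /= !FD.
  by rewrite /= !F_map_tens.
Defined.

Definition functor_F_raw : functor (RepG_f f) gpair_category :=
  functor_comp F_pair (inclusion _).

(* The proof [H] only serves to corestrict to [catC]; by proof irrelevance the
   functor does not depend on it. *)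
Definition functor_F (H : forall M : RepG_f f, in_C (functor_F_raw M)) :
  functor (RepG_f f) catC := corestrict H.
End Pairs.

(* Main.v *)
From HB Require Import structures.
From mathcomp Require Import all_boot all_order all_algebra generic_quotient.
From mathcomp Require Import ring zify.
From mathcomp Require Import boolp classical_sets cardinality fsbigop.
Require Import Defs.

(** Write [L = B[T, T^-1]] and [lambda : S -> L] for the map that inverts [f], so
    that [X] becomes [f^-1 (T - 1)]. The proof compares an [S]-coaction on [M] with a
    grading on [N], that is, with the [L]-coaction [x |-> \sum_i T^i (x) x_i], by
    means of the map [lambda (x) h : S (x) M -> L (x) N] attached to an [A]-linear map
    [h : M -> N] to a [B]-module ([lambda_tensor]).

    This map is injective when [h] is ([lambda_tensor_inj]). Indeed every element of
    [S (x) M] can be written [\sum_k T^-r X^k (x) m_k], and the [m_k] are recovered by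
    multiplying by [T^r] and taking coefficients in powers of [X]. These coefficients
    are [B]-linear functionals on [L], defined on the basis of the [T^i] by
    [T^i = (1 + f X)^i = \sum_n f^n binom(i, n) X^n] ([taylor_coef]). Hence at most
    one coaction on a lattice [M] of [N] induces the given grading, and linearity,
    coassociativity, counitality and compatibility with maps can all be checked in
    [L (x) N], where they are immediate on the powers of [T] ([tensor_coef_Delta],
    [tensor_coef_coact], [contract_counit], [lambda_tensor_tmap]).

    The coefficient of [X^n] in [\sum_i T^i (x) x_i] is [C_n x]. If the coaction comes
    from [S (x) M], these coefficients lie in [M], because elements of [S] have
    coefficients in [A] ([taylor_coef_lambda_tensor]); so the lattice of a comodule
    is stable under the [C_n]. Conversely, let [M] be stable under the [C_n], and let
    [x] be in [M]. For [r] large, [T^r \sum_i T^i (x) x_i] is a polynomial in [X]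
    ([taylor_tensor]), and its coefficients are in [M] since multiplication by
    [T = 1 + f X] preserves this property ([lattice_shifted_coef]). Thus
    [\sum_i T^i (x) x_i] comes from [S (x) M], which gives the coaction on [M]
    ([pair_comodule]).

    The two constructions are inverse to each other: a comodule on which [f] is
    injective embeds in its localization ([to_base_change_inj]) and is identified
    with its lattice ([unit_iso]), and a pair is recovered by [B (x) M -> N]
    ([counit_iso]). *)

Set Implicit Arguments.
Unset Strict Implicit.
Unset Printing Implicit Defensive.

Import GRing.Theory.
Local Open Scope quotient_scope.
Local Open Scope ring_scope.

(** * Additive and linear maps *)

Lemma additive0 (V W : zmodType) (g : V -> W) :
  {morph g : x y / x + y} -> g 0 = 0.
Proof. by move=> gD; apply: (addrI (g 0)); rewrite addr0 -gD addr0. Qed.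

Lemma additive_sum (V W : zmodType) (g : V -> W) (I : Type) (s : seq I) (x : I -> V) :
  {morph g : x y / x + y} -> g (\sum_(i <- s) x i) = \sum_(i <- s) g (x i).
Proof. by move=> gD; exact: (big_morph g gD (additive0 gD)). Qed.

Lemma linear_comp (R : pzRingType) (U V W : lmodType R) (g : V -> W) (k : U -> V) :
  linear g -> linear k -> linear (fun x => g (k x)).
Proof. by move=> gl kl a x y; rewrite kl gl. Qed.

(** Stated over an abstract algebra so that its instances for [S] and
    [B[T, T^-1]] are obtained by conversion, without rewriting through the
    restricted scalars. *)
Lemma restr_mul_linear (A R : comPzRingType) (phi : {rmorphism A -> R}) (r : R) :
  linear (fun x : restr phi R^o => (r * (x : R) : restr phi R^o)).
Proof. by move=> a x y; rewrite !restrZ /= mulrDr; congr (_ + _); apply: mulrCA. Qed.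

Section TensorZero.
Variables (A : comPzRingType) (M N : lmodType A).

Lemma tens_additive (m : M) : {morph (fun x : N => tens m x) : x y / x + y}.
Proof. by move=> x y; rewrite tensDr. Qed.

Lemma tens0r (m : M) : tens m (0 : N) = 0.
Proof. exact: (additive0 (tens_additive m)). Qed.

Lemma tens0l (x : N) : tens (0 : M) x = 0.
Proof. exact: (additive0 (fun m m' => tensDl m m' x)). Qed.
End TensorZero.

(** * Integer binomial coefficients *)

Definition fallz (i : int) (n : nat) : int := \prod_(k < n) (i - k%:Z).

Lemma fallzS i n : fallz (i + 1) n.+1 = (i + 1) * fallz i n.
Proof.
rewrite /fallz big_ord_recl subr0; congr (_ * _); apply: eq_bigr => k _.
by rewrite /= /bump /= add1n -addn1 PoszD; ring.
Qed.

Lemma fallzB i n : fallz (i + 1) n.+1 = fallz i n.+1 + n.+1%:Z * fallz i n.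
Proof.
rewrite fallzS /fallz big_ord_recr /= -addn1 PoszD; ring.
Qed.

(** By [fallzB], once [n!] is known to divide every product of [n] consecutive
    integers, divisibility by [(n + 1)!] at [i] and at [i + 1] are equivalent; so
    it propagates in both directions from [i = 0], where the product vanishes. *)
Lemma dvdz_fact_fallz i n : (n`!%:Z %| fallz i n)%Z.
Proof.
elim: n i => [|n IH] i; first by rewrite fact0 dvd1z.
have step j : (n.+1`!%:Z %| fallz (j + 1) n.+1)%Z = (n.+1`!%:Z %| fallz j n.+1)%Z.
  rewrite fallzB rpredDr // factS PoszM; apply: dvdz_mul => //; exact: dvdzz.
elim/int_rect: i => [|m|m].
- by rewrite /fallz big_ord_recl subr0 mul0r dvdz0.
- by rewrite -step; congr (_ %| fallz _ _)%Z; lia.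
- by move=> h; rewrite -step; move: h; congr (is_true (_ %| fallz _ _)%Z); lia.
Qed.

Lemma binzE i n : binz i n * n`!%:Z = fallz i n.
Proof. exact/divzK/dvdz_fact_fallz. Qed.

Lemma binz0 i : binz i 0 = 1.
Proof. by rewrite /binz big_ord0. Qed.

(** Pascal's rule. It is what makes stability under all the [C_n] survive
    multiplication by powers of [T]. *)
Lemma binzS i n : binz (i + 1) n.+1 = binz i n.+1 + binz i n.
Proof.
have nz : n.+1`!%:Z != 0 :> int by rewrite eqz_nat -lt0n fact_gt0.
apply: (mulIf nz); rewrite mulrDl !binzE factS PoszM mulrCA binzE fallzB.
by rewrite mulrC.
Qed.

Lemma binz_nat (p n : nat) : binz p n = 'C(p, n).
Proof.
elim: p n => [|p IH] [|n]; rewrite ?binz0 ?bin0 //.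
  by rewrite /binz big_ord_recl subr0 mul0r div0z.
by rewrite -addn1 PoszD binzS !IH addn1 binS PoszD.
Qed.

(** * Bases of the Laurent polynomial algebra *)

(** Membership in the submodule generated by the family [e], as an induction
    principle: this avoids handling linear combinations. *)
Definition spanned (R : pzRingType) (V : lmodType R) (K : Type) (e : K -> V)
    (x : V) : Prop :=
  forall Q : V -> Prop, Q 0 -> (forall a k, Q (a *: e k)) ->
    (forall x y, Q x -> Q y -> Q (x + y)) -> Q x.

Section PresentedSpan.
Variables (A : comPzRingType) (I : Type) (E : set (term A I * term A I)).
Let P : comPzRingType := presented E.
Let struct : {rmorphism A -> P} := @pres_const _ _ E.
Let Pmod : lmodType A := restr struct P^o.
Variables (K : Type) (e : K -> P).
Hypothesis e1 : exists k, e k = 1.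
Hypothesis eM : forall k k', exists k'', e k * e k' = e k''.
Hypothesis egen : forall i, spanned (e : K -> Pmod) (pres_gen E i).

(** A multiplicative family containing [1] spans the algebra as soon as it spans
    the generators, since its span is then a subalgebra. *)
Lemma presented_spanned (x : P) : spanned (e : K -> Pmod) x.
Proof.
pose sp := spanned (e : K -> Pmod).
have spZ a k : sp (a *: (e k : Pmod)) by move=> Q Q0 QZ QD; apply: QZ.
have sp0 : sp 0 by [].
have spD u v : sp u -> sp v -> sp (u + v).
  by move=> hu hv Q Q0 QZ QD; exact: QD (hu Q Q0 QZ QD) (hv Q Q0 QZ QD).
have spM (u v : P) : sp u -> sp v -> sp (u * v).
  move=> hu hv; refine (hu (fun u => sp ((u : P) * v)) _ _ _) => [|a k|x1 x2 h1 h2].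
  - by rewrite mul0r.
  - refine (hv (fun v => sp ((a *: (e k : Pmod) : P) * (v : P))) _ _ _)
      => [|b k'|x1 x2 h1 h2].
    + by rewrite mulr0.
    + have [k'' ek] := eM k k'.
      suff -> : (a *: (e k : Pmod) : P) * (b *: (e k' : Pmod) : P)
         = (a * b) *: (e k'' : Pmod) by apply: spZ.
      rewrite !restrZ -ek rmorphM; exact: mulrACA.
    + by rewrite mulrDr; apply: spD.
  - by rewrite mulrDl; apply: spD.
have spC a : sp (struct a).
  have [k ek] := e1.
  have -> : struct a = a *: (e k : Pmod).
    by rewrite restrZ ek; apply/esym/mulr1.
  exact: spZ.
apply: pres_ind => [a|i|u v|u hu|u v]; rewrite -/P.
- exact: spC.
- exact: egen.
- exact: spD.
- by rewrite -mulN1r -(rmorph1 struct) -rmorphN; apply: spM.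
- exact: spM.
Qed.
End PresentedSpan.

Section LaurentBasis.
Variable B : comPzRingType.
Local Notation L := (laurent B).

Lemma lTzS i : lTz B (i + 1) = lT B * lTz B i.
Proof.
case: i => [n|n].
  have -> : n%:Z + 1 = n.+1 by lia.
  by rewrite /= exprS.
case: n => [|n].
  by rewrite /= expr1 lT_mul expr0.
have -> : Negz n.+1 + 1 = Negz n by lia.
by rewrite /= [lTinv B ^+ n.+2]exprS mulrA lT_mul mul1r.
Qed.

Lemma lTzD i j : lTz B (i + j) = lTz B i * lTz B j.
Proof.
elim/int_rect: i => [|n IH|n IH]; first by rewrite add0r /= expr0 mul1r.
  have -> : n.+1%:Z + j = n%:Z + j + 1 by lia.
  have -> : n.+1%:Z = n%:Z + 1 by lia.
  by rewrite !lTzS IH mulrA.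
have e : lTz B (- n%:Z) = lT B * lTz B (- n.+1%:Z).
  by rewrite -lTzS; congr lTz; lia.
have e' : lTz B (- n%:Z + j) = lT B * lTz B (- n.+1%:Z + j).
  by rewrite -lTzS; congr lTz; lia.
move: IH; rewrite e e' -mulrA => /(congr1 (fun x => lTinv B * x)).
by rewrite !mulrA ![lTinv B * _]mulrC !lT_mul !mul1r.
Qed.

Lemma laurent_ind (Q : L -> Prop) : Q 0 ->
  (forall (b : B) i, Q (b *: (lTz B i : laurent_mod B))) ->
  (forall x y, Q x -> Q y -> Q (x + y)) -> forall x, Q x.
Proof.
move=> Q0 QZ QD x; suff h : spanned (lTz B : int -> laurent_mod B) x by apply: h.
apply: presented_spanned => [|i j|g].
- by exists 0; rewrite /= expr0.
- by exists (i + j); rewrite lTzD.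
- move=> P P0 PZ PD; case: g.
  + by have := PZ 1 1; rewrite scale1r /= expr1.
  + by have := PZ 1 (-1); rewrite scale1r /= expr1.
Qed.

Lemma laurent_linear_ext (V : lmodType B) (g h : laurent_mod B -> V) :
  linear g -> linear h -> (forall i, g (lTz B i) = h (lTz B i)) -> g =1 h.
Proof.
move=> gl hl e; apply: laurent_ind => [|b i|x y ex ey].
- by rewrite -(scale0r (0 : laurent_mod B)) (linear_morphZ _ _ gl) (linear_morphZ _ _ hl)
  !scale0r.
- by rewrite (linear_morphZ _ _ gl) (linear_morphZ _ _ hl) e.
- by rewrite (linear_morphD gl) (linear_morphD hl) ex ey.
Qed.
End LaurentBasis.

(** * Freeness of the Laurent polynomial algebra *)

Section PolyShift.
Variables (B : comNzRingType) (V : lmodType B) (c : int -> V).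

(** The value at [p / X^n] of the linear map [X^i |-> c i] on Laurent
    polynomials. *)
Definition shift_val (p : {poly B}) (n : nat) : V :=
  \sum_(k < size p) p`_k *: c (k%:Z - n%:Z).

Lemma shift_val_wide (p : {poly B}) n m : (size p <= m)%N ->
  shift_val p n = \sum_(k < m) p`_k *: c (k%:Z - n%:Z).
Proof.
move=> le; rewrite /shift_val (big_ord_widen _ (fun k => p`_k *: c (k%:Z - n%:Z)) le).
rewrite big_mkcond; apply: eq_bigr => k _; case: ltnP => // h.
by rewrite nth_default ?scale0r.
Qed.

Lemma shift_valP b p q n :
  shift_val (b%:P * p + q) n = b *: shift_val p n + shift_val q n.
Proof.
pose m := maxn (size (b%:P * p + q)) (maxn (size p) (size q)).
rewrite !(@shift_val_wide _ _ m) ?leq_max ?leqnn ?orbT //.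
rewrite scaler_sumr -big_split; apply: eq_bigr => k _ /=.
by rewrite coefD coefCM scalerDl scalerA.
Qed.

Lemma shift_valX p n : shift_val ('X * p) n.+1 = shift_val p n.
Proof.
have le : (size ('X * p)%R <= (size p).+1)%N.
  by apply: leq_trans (size_polyMleq _ _) _; rewrite size_polyX.
rewrite (shift_val_wide _ le) big_ord_recl coefXM scale0r add0r.
apply: eq_bigr => k _; rewrite coefXM /=; congr (_ *: c _); rewrite /bump /=; lia.
Qed.

Lemma shift_valXn p n k : shift_val ('X^k * p) (k + n) = shift_val p n.
Proof.
elim: k => [|k IH]; first by rewrite expr0 mul1r.
by rewrite exprS -mulrA addSn shift_valX.
Qed.

Lemma shift_valXn0 k : shift_val 'X^k 0 = c k.
Proof.
rewrite /shift_val size_polyXn big_ord_recr big1 => [|i _] /=.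
  by rewrite add0r coefXn eqxx scale1r subr0.
by rewrite coefXn ltn_eqF // scale0r.
Qed.

Lemma shift_val1 n : shift_val 1 n = c (- n%:Z).
Proof. by rewrite /shift_val size_poly1 big_ord1 coefC scale1r sub0r. Qed.

Lemma shift_val_frac p n q m :
  frac ('X : {poly B}) p n = frac 'X q m -> shift_val p n = shift_val q m.
Proof.
move/frac_eq => [k e].
rewrite -(shift_valXn p n (k + m)) e -(shift_valXn q m (k + n)).
by congr shift_val; rewrite -!addnA (addnC m).
Qed.

Definition loc_val (x : loc ('X : {poly B})) : V :=
  let y := repr (x : {eq_quot (loc_equiv ('X : {poly B}))}) in shift_val y.1 y.2.

Lemma loc_valE p n : loc_val (frac 'X p n) = shift_val p n.
Proof.
by apply: shift_val_frac; rewrite /frac -surjective_pairing reprK.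
Qed.

Lemma loc_valP (b : B) x y :
  loc_val (loc_const 'X b%:P * x + y) = b *: loc_val x + loc_val y.
Proof.
elim/frac_ind: x => p n; elim/frac_ind: y => q m.
rewrite fracM fracD add0n !loc_valE mulrCA shift_valP shift_valXn.
by rewrite addnC shift_valXn.
Qed.

(** The algebra is only known through its maps to other commutative rings, so
    the independence of the [T^i] has to be read in a concrete model: the ring of
    fractions [p / X^n] with [p] a polynomial. *)
Lemma laurent_free_nz : exists g : laurent_mod B -> V,
  linear g /\ forall i, g (lTz B i) = c i.
Proof.
pose R : comPzRingType := loc ('X : {poly B}).
pose phi : {rmorphism B -> R} := loc_const ('X : {poly B}) \o polyC.
pose v (i : laurent_gens) : R :=
  if i is LT then loc_const 'X 'X else frac 'X 1 1.
have vE : satisfies [set (Mul (Gen LT) (Gen LTinv), Const 1)]%classic phi v.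
  by move=> e -> /=; rewrite rmorph1 frac_inv.
have lc (b : B) : pres_lift vE (laurent_struct B b) = loc_const 'X b%:P.
  exact: pres_lift_const.
exists (fun x : laurent B => loc_val (pres_lift vE x)); split=> [b x y|i].
  rewrite -loc_valP -lc -rmorphM -rmorphD; congr (loc_val (pres_lift vE _)).
have lT1 : pres_lift vE (lT B) = loc_const 'X 'X by exact: pres_lift_gen.
have lT2 : pres_lift vE (lTinv B) = frac 'X 1 1 by exact: pres_lift_gen.
case: i => n; rewrite /lTz rmorphXn /= ?lT1 ?lT2.
  by rewrite -rmorphXn /= loc_valE shift_valXn0.
suff -> : frac ('X : {poly B}) 1 1 ^+ n.+1 = frac 'X 1 n.+1.
  by rewrite loc_valE shift_val1.
elim: n.+1 => [//|k IH]; by rewrite exprS IH fracM mulr1 add1n.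
Qed.
End PolyShift.

(** Polynomials are available over nontrivial rings; over the zero ring every
    module is zero. *)
Lemma laurent_free (B : comPzRingType) (V : lmodType B) (c : int -> V) :
  exists g : laurent_mod B -> V, linear g /\ forall i, g (lTz B i) = c i.
Proof.
have [h|h] := eqVneq (1 : B) 0.
  have V0 (v w : V) : v = w by rewrite -[v]scale1r -[w]scale1r h !scale0r.
  by exists (fun=> 0); split=> [b x y|i]; apply: V0.
(* Exposing the class of [B] makes the two ring structures on its carrier
   convertible. *)
case: B V c h => T cls V c h.
pose B : comPzRingType := GRing.ComPzRing.Pack cls.
pose B' : comNzRingType := HB.pack_for comNzRingType T
  B (GRing.PzSemiRing_isNonZero.Build B h).
exact: (@laurent_free_nz B' V c).
Qed.

(** * Sums with finite support *)

Section FiniteSupport.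
Variables (I : choiceType) (V W : zmodType).

Definition finsupp (x : I -> V) : Prop := finite_set [set i | x i != 0].

Lemma finsuppP (x : I -> V) : finsupp x <->
  exists s : seq I, uniq s /\ forall i, i \notin s -> x i = 0.
Proof.
split=> [/finite_seqP[s e]|[s [_ h]]].
  exists (undup s); split=> [|i]; first exact: undup_uniq.
  rewrite mem_undup => h; apply/eqP/negP => /negP xi.
  suff : i \in s by rewrite (negbTE h).
  by have : [set i | x i != 0]%classic i by []; rewrite e.
apply: (@sub_finite_set _ _ [set` s]); last exact: finite_seq.
by move=> i /= xi; apply: contraNT xi => /h ->.
Qed.

Lemma fsumE (x : I -> V) s : uniq s -> (forall i, i \notin s -> x i = 0) ->
  \sum_(i \in [set: I]) x i = \sum_(i <- s) x i.
Proof.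
move=> us h; rewrite (fsbigE s) // => [|i _]; last exact: h.
by apply: eq_bigl => i; rewrite in_setT.
Qed.

Lemma finsupp2 (x y : I -> V) : finsupp x -> finsupp y -> exists s : seq I,
  [/\ uniq s, forall i, i \notin s -> x i = 0 & forall i, i \notin s -> y i = 0].
Proof.
move=> /finsuppP[s [us hs]] /finsuppP[t [ut ht]]; exists (undup (s ++ t)).
by split; rewrite ?undup_uniq // => i; rewrite mem_undup mem_cat negb_or
  => /andP[h1 h2]; rewrite (hs, ht).
Qed.

Lemma fsumD (x y : I -> V) : finsupp x -> finsupp y ->
  finsupp (fun i => x i + y i) /\
  \sum_(i \in [set: I]) (x i + y i)
    = \sum_(i \in [set: I]) x i + \sum_(i \in [set: I]) y i.
Proof.
move=> hx hy; have [s [us h1 h2]] := finsupp2 hx hy.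
have h i : i \notin s -> x i + y i = 0 by move=> hi; rewrite h1 // h2 // addr0.
split; first by apply/finsuppP; exists s.
by rewrite !(fsumE us) // big_split.
Qed.

Lemma fsum1 (x : I -> V) i : (forall j, j != i -> x j = 0) ->
  finsupp x /\ \sum_(j \in [set: I]) x j = x i.
Proof.
move=> h; have h' j : j \notin [:: i] -> x j = 0 by rewrite inE; apply: h.
split; first by apply/finsuppP; exists [:: i].
by rewrite (@fsumE _ [:: i]) // big_seq1.
Qed.
End FiniteSupport.

Lemma fsum_additive (I : choiceType) (V W : zmodType) (g : V -> W) (x : I -> V) :
  {morph g : x y / x + y} -> finsupp x ->
  finsupp (fun i => g (x i)) /\
  g (\sum_(i \in [set: I]) x i) = \sum_(i \in [set: I]) g (x i).
Proof.
move=> gD /finsuppP[s [us h]].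
have h' i : i \notin s -> g (x i) = 0 by move/h->; exact: additive0.
split; first by apply/finsuppP; exists s.
by rewrite !(fsumE us) // additive_sum.
Qed.

(** * Tensoring with Laurent polynomials *)

Section LaurentTensor.
Variable B : comPzRingType.
Local Notation L := (laurent_mod B).

Definition laurent_extend (V : lmodType B) (c : int -> V) : L -> V :=
  sval (cid (laurent_free c)).

Lemma laurent_extend_linear (V : lmodType B) (c : int -> V) : linear (laurent_extend c).
Proof. by rewrite /laurent_extend; case: cid => g []. Qed.

Lemma laurent_extendE (V : lmodType B) (c : int -> V) i : laurent_extend c (lTz B i) = c i.
Proof. by rewrite /laurent_extend; case: cid => g []. Qed.

Definition laurent_coef (i : int) : L -> B^o := @laurent_extend B^o (fun j => (j == i)%:R).

Lemma laurent_coefE i j : laurent_coef i (lTz B j) = (j == i)%:R.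
Proof. exact: laurent_extendE. Qed.

Section Contract.
Variable N : lmodType B.
Local Notation LN := (tensor L N).

(** [phi (x) id : L (x) N -> B (x) N = N]. *)
Definition contract (phi : L -> B^o) : LN -> N :=
  tlift (fun l x => (phi l : B) *: x).

Variable phi : L -> B^o.
Hypothesis phil : linear phi.

Lemma contract_bilinear : bilinear (fun l (x : N) => (phi l : B) *: x).
Proof.
split=> [x|l] a y z; first by rewrite phil scalerDl scalerA.
by rewrite scalerDr !scalerA mulrC.
Qed.

Lemma contract_linear : linear (contract phi).
Proof. exact: tlift_linear contract_bilinear. Qed.

Lemma contract_tens l x : contract phi (tens l x) = phi l *: x.
Proof. exact: tliftE contract_bilinear. Qed.
End Contract.

Section Coefficients.
Variable N : lmodType B.
Local Notation LN := (tensor L N).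

Definition tensor_coef (i : int) : LN -> N := contract (laurent_coef i).

Lemma tensor_coef_linear i : linear (tensor_coef i).
Proof. exact/contract_linear/laurent_extend_linear. Qed.

Lemma tensor_coefE i j x : tensor_coef i (tens (lTz B j : L) x) = (j == i)%:R *: x.
Proof.
rewrite /tensor_coef contract_tens ?laurent_coefE //; exact: laurent_extend_linear.
Qed.

Definition laurent_sum (x : int -> N) : LN :=
  \sum_(i \in [set: int]) tens (lTz B i : L) (x i).

Lemma finsupp_tens (x : int -> N) : finsupp x ->
  finsupp (fun i => tens (lTz B i : L) (x i)).
Proof.
move=> /finsuppP[s [us h]]; apply/finsuppP; exists s; split=> // i /h ->.
exact: tens0r.
Qed.

Lemma tensor_coef_laurent_sum (x : int -> N) i : finsupp x -> tensor_coef i (laurent_sum x) = x i.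
Proof.
move=> /finsupp_tens fx; have gD := linear_morphD (tensor_coef_linear i).
rewrite /laurent_sum (fsum_additive gD fx).2 (fsum1 (i := i) _).2;
  rewrite ?tensor_coefE ?eqxx ?scale1r //.
by move=> j /negbTE ji; rewrite tensor_coefE ji scale0r.
Qed.

(** [L (x) N] is the direct sum of the [T^i (x) N], with projections
    [tensor_coef i]. *)
Lemma laurent_sumP (w : LN) : finsupp (tensor_coef^~ w) /\ w = laurent_sum (tensor_coef^~ w).
Proof.
suff [x fx e] : exists2 x : int -> N, finsupp x & w = laurent_sum x.
  have ex : tensor_coef^~ w = x by apply/funext => i; rewrite e tensor_coef_laurent_sum.
  by rewrite ex.
have S1 i (y : N) : exists2 x : int -> N, finsupp x & tens (lTz B i : L) y = laurent_sum x.
  pose x j := if j == i then y else 0.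
  have xi j : j != i -> x j = 0 by rewrite /x => /negbTE ->.
  exists x; first exact: (fsum1 xi).1.
  rewrite /laurent_sum (fsum1 (i := i) _).2 /x ?eqxx // => j /negbTE ->.
  exact: tens0r.
have S0 : exists2 x : int -> N, finsupp x & (0 : LN) = laurent_sum x.
  by rewrite -(tens0r N (lTz B 0 : L)); apply: S1.
have SD (u v : LN) : (exists2 x : int -> N, finsupp x & u = laurent_sum x) ->
    (exists2 x : int -> N, finsupp x & v = laurent_sum x) ->
    exists2 x : int -> N, finsupp x & u + v = laurent_sum x.
  move=> [x fx ->] [y fy ->]; exists (fun i => x i + y i); first exact: (fsumD fx fy).1.
  rewrite /laurent_sum -(fsumD (finsupp_tens fx) (finsupp_tens fy)).2.
  by apply: eq_fsbigr => i _; rewrite tensDr.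
elim/tensor_ind: w => // l y; move: l.
apply: laurent_ind => [|b i|u v hu hv].
- by rewrite (tens0l L).
- by rewrite tensZl -tensZr; apply: S1.
- by rewrite tensDl; apply: SD.
Qed.

Lemma laurent_tensor_ext (w w' : LN) : (forall i, tensor_coef i w = tensor_coef i w') -> w = w'.
Proof.
by move=> e; rewrite (laurent_sumP w).2 (laurent_sumP w').2; congr laurent_sum; apply/funext.
Qed.

Lemma contract_laurent_sum phi (x : int -> N) : linear phi -> finsupp x ->
  contract phi (laurent_sum x) = \sum_(i \in [set: int]) phi (lTz B i) *: x i.
Proof.
move=> pl /finsupp_tens fx; have gD := linear_morphD (contract_linear (N := N) pl).
rewrite /laurent_sum (fsum_additive gD fx).2; apply: eq_fsbigr => i _.
by rewrite contract_tens.
Qed.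
End Coefficients.
End LaurentTensor.

(** * Coefficients of the expansion in powers of X *)

Section TaylorCoefficients.
Variables (A : comPzRingType) (f : A).
Local Notation B := (loc f).
Local Notation iota := (loc_const f : {rmorphism A -> B}).
Local Notation L := (laurent_mod B).

(** The coefficient of [X^n] in the expansion of a Laurent polynomial in
    [T = 1 + f X] as a power series in [X], because
    [(1 + f X)^i = \sum_n f^n binom(i, n) X^n]. *)
Definition taylor_coef (n : nat) : L -> B^o :=
  @laurent_extend B B^o (fun i => iota f ^+ n * (binz i n)%:~R).

Lemma taylor_coef_linear n : linear (taylor_coef n).
Proof. exact: laurent_extend_linear. Qed.

Lemma taylor_coefE n i : taylor_coef n (lTz B i) = iota f ^+ n * (binz i n)%:~R.
Proof. exact: laurent_extendE. Qed.

Lemma laurent_mul_linear (l : laurent B) :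
  linear (fun x : L => (l * (x : laurent B) : L)).
Proof. exact: restr_mul_linear. Qed.

Lemma taylor_coef0T (x : laurent B) : taylor_coef 0 (lT B * x) = taylor_coef 0 x.
Proof.
have d0 := taylor_coef_linear 0; have ml := laurent_mul_linear (lT B).
apply: (laurent_linear_ext (V := B^o) (g := fun x : L => taylor_coef 0 (lT B * (x : laurent
  B)))) => //.
  by move=> a y z; rewrite ml d0.
by move=> i; rewrite -lTzS !taylor_coefE !binz0.
Qed.

(** Multiplication by [T = 1 + f X] acts on coefficients in this way by Pascal's
    rule. *)
Lemma taylor_coefST n (x : laurent B) :
  taylor_coef n.+1 (lT B * x) = taylor_coef n.+1 x + iota f * taylor_coef n x.
Proof.
have dl k := taylor_coef_linear k; have ml := laurent_mul_linear (lT B).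
apply: (laurent_linear_ext (V := B^o) (g := fun x : L => taylor_coef n.+1 (lT B * (x : laurent
  B)))
  (h := fun x : L => taylor_coef n.+1 x + iota f * taylor_coef n x)).
- by move=> a y z; rewrite ml dl.
- move=> a y z; rewrite !dl mulrDr addrACA scalerDr; do 2!congr (_ + _).
  exact: mulrCA.
- by move=> i; rewrite -lTzS !taylor_coefE binzS rmorphD mulrDr exprS -!mulrA.
Qed.

Definition lX : laurent B := lambda f (sX f).

Lemma lXE : lX = frac f 1 1 *: (lT B - 1 : L).
Proof. exact: pres_lift_gen. Qed.

Lemma iota_fK (b : B) : frac f 1 1 * (iota f * b) = b.
Proof. by rewrite mulrA (mulrC (frac f 1 1)) frac_inv mul1r. Qed.

Lemma lT_lX : lT B = 1 + iota f *: (lX : L).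
Proof.
rewrite lXE scalerA frac_inv scale1r; exact: (esym (subrKC _ _)).
Qed.

Lemma taylor_coefX n (x : laurent B) :
  taylor_coef n (lX * x) = if n is n'.+1 then taylor_coef n' x else 0.
Proof.
have -> : lX * x = frac f 1 1 *: ((lT B * x : L) - (x : L)).
  rewrite lXE; transitivity (laurent_struct B (frac f 1 1) * (lT B - 1) * x) => //.
  by rewrite -mulrA mulrBl mul1r.
have dl := taylor_coef_linear n.
have -> : taylor_coef n (frac f 1 1 *: ((lT B * x : L) - (x : L)))
    = frac f 1 1 * (taylor_coef n (lT B * x) - taylor_coef n x).
  rewrite (linear_morphZ _ _ dl); congr (_ * _).
  by rewrite (linear_morphD dl) -scaleN1r (linear_morphZ _ _ dl) scaleN1r.
case: n {dl} => [|n]; first by rewrite taylor_coef0T subrr mulr0.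
by rewrite taylor_coefST addrC addKr iota_fK.
Qed.

Lemma taylor_coefXn n k (x : laurent B) :
  taylor_coef n (lX ^+ k * x) = if (k <= n)%N then taylor_coef (n - k) x else 0.
Proof.
elim: k n => [|k IH] n; first by rewrite expr0 mul1r subn0.
rewrite exprS -mulrA taylor_coefX; case: n => [//|n]; exact: IH.
Qed.

Local Notation S := (G_mod f).
Local Notation sx := (sX f).
Local Notation st := (sT f).
Local Notation sti := (sTinv f).

(** [T^-r X^k]. These span [S], since [T = 1 + f X]. *)
Definition TX_mon (r k : nat) : G_alg f := sti ^+ r * sx ^+ k.

Lemma sT_sX : st = 1 + f *: (sx : S).
Proof.
have [_ h] := G_point_gen f.
transitivity (st - 1 + 1); first by rewrite subrK.
by rewrite h addrC.
Qed.

Lemma TX_monM r k r' k' : TX_mon r k * TX_mon r' k' = TX_mon (r + r') (k + k').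
Proof. by rewrite /TX_mon !exprD mulrACA. Qed.

(** Follows from [T^-r = T^-(r + 1) (1 + f X)]; it serves to bring several
    monomials to the same power of [T^-1]. *)
Lemma TX_mon_raise r k : TX_mon r k = TX_mon r.+1 k + f *: (TX_mon r.+1 k.+1 : S).
Proof.
have [h _] := G_point_gen f.
have -> : TX_mon r k = st * TX_mon r.+1 k by rewrite /TX_mon exprS !mulrA h mul1r.
rewrite sT_sX mulrDl mul1r; congr (_ + _).
transitivity (G_struct f f * sx * TX_mon r.+1 k); first by [].
transitivity (G_struct f f * TX_mon r.+1 k.+1); last by [].
by rewrite /TX_mon -mulrA [sx ^+ k.+1]exprS (mulrCA sx).
Qed.

Lemma G_alg_ind (Q : S -> Prop) : Q 0 ->
  (forall a r k, Q (a *: (TX_mon r k : S))) ->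
  (forall x y, Q x -> Q y -> Q (x + y)) -> forall x, Q x.
Proof.
move=> Q0 QZ QD x.
suff h : spanned (fun rk => TX_mon rk.1 rk.2 : S) x by apply: h => // a [r k].
apply: presented_spanned => [|[r k] [r' k']|g].
- by exists (0, 0)%N; rewrite /TX_mon !expr0 mulr1.
- by exists (r + r', k + k')%N; rewrite TX_monM.
- move=> P P0 PZ PD; case: g.
  + suff -> : pres_gen (G_rels f) GT = 1 *: (TX_mon 0 0 : S) + f *: (TX_mon 0 1 : S).
      by apply: PD; [apply: (PZ _ (0, 0)%N) | apply: (PZ _ (0, 1)%N)].
    by rewrite scale1r /TX_mon !expr0 mulr1 expr1 mul1r -sT_sX.
  + by have := PZ 1 (1, 0)%N; rewrite scale1r /TX_mon expr0 expr1 mulr1.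
  + by have := PZ 1 (0, 1)%N; rewrite scale1r /TX_mon expr0 expr1 mul1r.
Qed.

(** All of these, rather than normalized powers of [T], so that no case
    distinction on signs is needed. *)
Definition sTpq (p q : nat) : G_alg f := st ^+ p * sti ^+ q.

Lemma lambda_sT : lambda f st = lT B. Proof. exact: pres_lift_gen. Qed.
Lemma lambda_sTinv : lambda f sti = lTinv B. Proof. exact: pres_lift_gen. Qed.

Lemma lTinvX q : lTinv B ^+ q = lTz B (- q%:Z).
Proof. by case: q => [|q]; rewrite ?expr0. Qed.

Lemma lambda_sTpq p q : lambda f (sTpq p q) = lTz B (p%:Z - q%:Z).
Proof. by rewrite rmorphM !rmorphXn /= lambda_sT lambda_sTinv lTinvX lTzD. Qed.

Lemma loc_scaleI (V : lmodType B) (v w : V) : iota f *: v = iota f *: w -> v = w.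
Proof.
move=> /(congr1 (fun x => frac f 1 1 *: x)).
by rewrite !scalerA mulrC frac_inv !scale1r.
Qed.

(** Once [f] is invertible, the powers of [T] span: [f X = T - 1] lets one remove
    the powers of [X] one at a time. *)
Lemma G_linear_ext (V : lmodType B) (g h : S -> restr iota V) :
  linear g -> linear h -> (forall p q, g (sTpq p q) = h (sTpq p q)) -> g =1 h.
Proof.
move=> gl hl e; have gD := linear_morphD gl; have hD := linear_morphD hl.
have e' k p q : g (sTpq p q * sx ^+ k) = h (sTpq p q * sx ^+ k).
  elim: k p q => [|k IH] p q; first by rewrite expr0 mulr1.
  apply: (@loc_scaleI V); change (f *: g (sTpq p q * sx ^+ k.+1) = f *: h (sTpq p q * sx ^+
    k.+1)).
  rewrite -(linear_morphZ f _ gl) -(linear_morphZ f _ hl).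
  have E : sTpq p.+1 q * sx ^+ k
      = sTpq p q * sx ^+ k + f *: (sTpq p q * sx ^+ k.+1 : S).
    have -> : sTpq p.+1 q = st * sTpq p q by rewrite /sTpq exprS mulrA.
    rewrite sT_sX !mulrDl mul1r; congr (_ + _).
    transitivity (G_struct f f * sx * sTpq p q * sx ^+ k); first by [].
    transitivity (G_struct f f * (sTpq p q * sx ^+ k.+1)); last by [].
    by move: (sTpq p q) => t; rewrite [sx ^+ k.+1]exprS -!mulrA (mulrCA sx).
  have := IH p.+1 q; rewrite E => eE.
  apply: (addrI (g (sTpq p q * sx ^+ k))).
  by rewrite -gD eE hD IH.
apply: G_alg_ind => [|a r k|x y ex ey].
- by rewrite (additive0 gD) (additive0 hD).
- rewrite (linear_morphZ _ _ gl) (linear_morphZ _ _ hl); congr (_ *: _).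
  by have := e' k 0%N r; rewrite /sTpq expr0 mul1r.
- by rewrite gD hD ex ey.
Qed.

Lemma lambda_TX_mon r k : lambda f (TX_mon r k) = lTz B (- r%:Z) * lX ^+ k.
Proof.
by rewrite rmorphM !rmorphXn /= lambda_sTinv lTinvX.
Qed.

End TaylorCoefficients.

(** * The embedding of S (x) M into L (x) N *)

Section CoactionMap.
Variables (A : comPzRingType) (f : A).
Local Notation B := (loc f).
Local Notation iota := (loc_const f : {rmorphism A -> B}).
Local Notation L := (laurent_mod B).
Local Notation S := (G_mod f).

Section LambdaTensor.
Variables (M : lmodType A) (N : lmodType B) (h : M -> restr iota N).
Local Notation LN := (tensor L N).

(** [lambda (x) h]. For [h] injective it is injective, and thus detects equalities
    in [S (x) M]; this is how every property of a coaction on [M] is read in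
    [L (x) N]. *)
Definition lambda_tensor : tensor S M -> restr iota LN :=
  tlift (fun (s : S) (m : M) => (tens (lambda f s : L) (h m : N) : restr iota LN)).

Hypothesis hl : linear h.

Lemma lambda_tensor_bilinear : bilinear (fun (s : S) (m : M) =>
  (tens (lambda f s : L) (h m : N) : restr iota LN)).
Proof.
split=> [m|s] a x y.
  transitivity (tens (iota a *: (lambda f x : L) + lambda f y) (h m : N)).
    congr tens; rewrite -lambdaZ; exact: (rmorphD (lambda f)).
  exact: etrans (tensDl _ _ _) (congr1 (+%R^~ _) (tensZl _ _ _)).
transitivity (tens (lambda f s : L) (iota a *: (h x : N) + (h y : N))).
  congr tens; exact: hl.
exact: etrans (tensDr _ _ _) (congr1 (+%R^~ _) (tensZr _ _ _)).
Qed.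

Lemma lambda_tensor_linear : linear lambda_tensor.
Proof. exact: tlift_linear lambda_tensor_bilinear. Qed.

Lemma lambda_tensorE s m : lambda_tensor (tens (s : S) m) = tens (lambda f s : L) (h m : N).
Proof. exact: tliftE lambda_tensor_bilinear. Qed.

Definition X_expansion (r n : nat) (m : nat -> M) : tensor S M :=
  \sum_(k < n) tens (TX_mon f r k : S) (m k).

Lemma X_expansion_raise r n m : exists m', X_expansion r n m = X_expansion r.+1 n.+1 m'.
Proof.
exists (fun k => (if (k < n)%N then m k else 0) + (if k is k'.+1 then f *: m k' else 0)).
rewrite /X_expansion; under eq_bigr => k _ do rewrite TX_mon_raise tensDl tensZl -tensZr.
rewrite big_split; under [RHS]eq_bigr => k _ do rewrite tensDr.
rewrite [RHS]big_split; congr (_ + _).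
  rewrite big_ord_recr /= ltnn tens0r addr0.
  by apply: eq_bigr => k _; rewrite ltn_ord.
rewrite big_ord_recl /= tens0r add0r.
by apply: eq_bigr.
Qed.

Lemma X_expansion_raises r n m k : exists n' m', X_expansion r n m = X_expansion (k + r) n' m'.
Proof.
elim: k => [|k [n' [m' ->]]]; first by exists n, m.
by have [m'' ->] := X_expansion_raise (k + r) n' m'; exists n'.+1, m''.
Qed.

Lemma X_expansion_widen r n m k : exists m', X_expansion r n m = X_expansion r (n + k) m'.
Proof.
exists (fun i => if (i < n)%N then m i else 0).
rewrite /X_expansion big_split_ord /= [X in _ + X]big1 => [|i _].
  by rewrite addr0; apply: eq_bigr => i _; rewrite ltn_ord.
by rewrite ltnNge leq_addr /= tens0r.
Qed.

(** The elements [T^-r X^k (x) m] generate; raising [r] and padding with zeros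
    make the sum of two expansions an expansion. *)
Lemma X_expansionP (u : tensor S M) : exists r n m, u = X_expansion r n m.
Proof.
pose Q u := exists r n m, u = X_expansion r n m; rewrite -/(Q u).
have Q1 r k m : Q (tens (TX_mon f r k : S) m).
  exists r, k.+1, (fun i => if i == k then m else 0).
  rewrite /X_expansion big_ord_recr /= eqxx big1 ?add0r // => i _.
  by rewrite ltn_eqF // tens0r.
have Q0 : Q 0 by exists 0%N, 0%N, (fun=> 0); rewrite /X_expansion big_ord0.
have QD x y : Q x -> Q y -> Q (x + y).
  move=> [r [n [m ->]]] [r' [n' [m' ->]]].
  have [n1 [m1 ->]] := X_expansion_raises r n m r'.
  have [n2 [m2 ->]] := X_expansion_raises r' n' m' r.
  have [m3 ->] := X_expansion_widen (r' + r) n1 m1 n2.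
  have [m4 ->] := X_expansion_widen (r + r') n2 m2 n1.
  rewrite (addnC r') (addnC n2).
  exists (r + r')%N, (n1 + n2)%N, (fun k => m3 k + m4 k).
  by rewrite /X_expansion -big_split; apply: eq_bigr => k _; rewrite tensDr.
move: u; apply: tensor_ind => // s m; move: s.
apply: G_alg_ind => [|a r k|x y hx hy].
- by rewrite tens0l.
- by rewrite tensZl -tensZr; apply: Q1.
- by rewrite tensDl; apply: QD.
Qed.

(** The coefficient of [X^n] in [T^r l]. *)
Definition shifted_coef (r n : nat) (l : L) : B^o := taylor_coef n (lTz B r * (l : laurent B) :
  L).

Lemma shifted_coef_linear r n : linear (shifted_coef r n).
Proof.
move=> b x y.
exact: etrans (congr1 (taylor_coef n) (laurent_mul_linear (lTz B r) b x y))
  (taylor_coef_linear n b _ _).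
Qed.

Lemma shifted_coef_TX_mon r n k : shifted_coef r n (lambda f (TX_mon f r k)) = (k == n)%:R.
Proof.
rewrite /shifted_coef lambda_TX_mon mulrA -lTzD subrr -[X in X * _]/(1 : laurent B) mul1r.
rewrite -[lX f ^+ k]mulr1 taylor_coefXn.
case: (ltngtP k n) => [kn|//|->]; last first.
  by rewrite subnn (taylor_coefE f 0 0) binz0 mulr1 expr0.
have [j ->] : exists j, (n - k = j.+1)%N by exists (n - k).-1; lia.
by rewrite (taylor_coefE f _ 0) (binz_nat 0) mulr0.
Qed.

Lemma shifted_coef_lambda_tensor r n m j : (j < n)%N ->
  contract (shifted_coef r j) (lambda_tensor (X_expansion r n m) : LN) = h (m j).
Proof.
move=> jn; have cD := linear_morphD (contract_linear (N := N) (shifted_coef_linear r j)).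
have jD := linear_morphD lambda_tensor_linear.
rewrite /X_expansion (additive_sum _ _ jD).
rewrite [LHS](additive_sum (V := LN) _ _ cD).
rewrite (bigD1 (Ordinal jn)) //= big1 ?addr0 => [|i /eqP/val_eqP /= ij];
  rewrite lambda_tensorE contract_tens ?shifted_coef_TX_mon; try exact: shifted_coef_linear.
  by rewrite eqxx scale1r.
by rewrite (negbTE ij) scale0r.
Qed.

(** Write an element of the kernel as [\sum_k T^-r X^k (x) m_k]; multiplying by [T^r]
    and taking the coefficient of [X^j] gives [h m_j = 0]. *)
Lemma lambda_tensor_inj : injective h -> injective lambda_tensor.
Proof.
move=> hI u v e; apply/eqP; rewrite -subr_eq0; apply/eqP.
have jD := linear_morphD lambda_tensor_linear.
have : lambda_tensor (u - v) = 0.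
  by rewrite jD -scaleN1r (linear_morphZ _ _ lambda_tensor_linear) e scaleN1r subrr.
have [r [n [m ->]]] := X_expansionP (u - v) => e0.
rewrite /X_expansion big1 // => k _; rewrite (_ : m k = 0) ?tens0r //.
apply: hI; rewrite -(shifted_coef_lambda_tensor r m (ltn_ord k)) e0.
rewrite (additive0 (linear_morphD hl)).
exact: (additive0 (linear_morphD (contract_linear (N := N) (shifted_coef_linear r k)))).
Qed.

(** The expansion in powers of [X] of an element of [S] has coefficients in [A], so
    the coefficients of an element of [S (x) M] lie in [M]. This is why the lattice
    of a comodule is stable under the [C_n]. *)
Lemma taylor_coef_lambda_tensor n u : exists m, contract (taylor_coef n) (lambda_tensor u : LN)
  = h m.
Proof.
have cD := linear_morphD (contract_linear (N := N) (taylor_coef_linear (f := f) n)).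
have jD := linear_morphD lambda_tensor_linear; have hD := linear_morphD hl.
pose Q u := exists m, contract (taylor_coef n) (lambda_tensor u : LN) = h m; rewrite -/(Q u).
have QD x y : Q x -> Q y -> Q (x + y).
  move=> [m e] [m' e']; exists (m + m').
  by rewrite jD hD -e -e'; apply: cD.
have Q0 : Q 0.
  by exists 0; rewrite (additive0 jD) (additive0 hD); apply: (additive0 cD).
move: u; apply: tensor_ind => // s m; move: s.
apply: G_alg_ind => [|a r k|x y hx hy].
- by rewrite tens0l.
- rewrite tensZl -tensZr /Q lambda_tensorE contract_tens; last exact: taylor_coef_linear.
  rewrite lambda_TX_mon mulrC taylor_coefXn; case: leqP => _; last first.
    by exists 0; rewrite scale0r (additive0 hD).
  rewrite taylor_coefE.
  exists ((f ^+ (n - k) * (binz (- r%:Z) (n - k))%:~R) *: (a *: m)).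
  by rewrite (linear_morphZ _ (a *: m) hl) restrZ rmorphM rmorphXn /= rmorph_int.
- by rewrite tensDl; apply: QD.
Qed.
End LambdaTensor.
End CoactionMap.

(** * Comultiplication and counit seen in Laurent polynomials *)

Section Coassociativity.
Variables (A : comPzRingType) (f : A).
Local Notation B := (loc f).
Local Notation iota := (loc_const f : {rmorphism A -> B}).
Local Notation L := (laurent_mod B).
Local Notation S := (G_mod f).

Definition Delta : S -> tensor S S := G_Delta f.

Lemma Delta_linear : linear Delta.
Proof.
have DZ a s : Delta (a *: s) = a *: Delta s.
  transitivity (G_Delta f (G_struct f a) * G_Delta f s).
    exact: (rmorphM (G_Delta f) (G_struct f a) s).
  have -> : G_Delta f (G_struct f a) = tensor_struct (G_struct f) (G_struct f) a.
    exact: pres_lift_const.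
  exact: etrans (tensor_algZ _ _ _) (congr1 _ (mul1r _)).
by move=> a s t; rewrite -DZ; apply: (rmorphD (G_Delta f)).
Qed.

Lemma eps_linear : linear (G_eps f : S -> A^o).
Proof.
move=> a s t; transitivity (G_eps f (G_struct f a * s) + G_eps f t).
  exact: (rmorphD (G_eps f)).
have e : G_eps f (G_struct f a) = a by exact: pres_lift_const.
by rewrite rmorphM e.
Qed.

Lemma Delta_sTpq p q : Delta (sTpq f p q) = tens (sTpq f p q : S) (sTpq f p q : S).
Proof.
have M r s r' s' : pure (f := f) r s * pure r' s' = pure (r * r') (s * s').
  exact: tensor_algM.
have X r s n : pure (f := f) r s ^+ n = pure (r ^+ n) (s ^+ n).
  by elim: n => [//|n IH]; rewrite !exprS IH M.
transitivity (G_Delta f (sT f) ^+ p * G_Delta f (sTinv f) ^+ q).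
  by rewrite -!rmorphXn -rmorphM.
have -> : G_Delta f (sT f) = pure (sT f) (sT f) by exact: pres_lift_gen.
have -> : G_Delta f (sTinv f) = pure (sTinv f) (sTinv f) by exact: pres_lift_gen.
by rewrite !X M.
Qed.

Lemma eps_sTpq p q : G_eps f (sTpq f p q) = 1.
Proof.
have e1 : G_eps f (sT f) = 1 by exact: pres_lift_gen.
have e2 : G_eps f (sTinv f) = 1 by exact: pres_lift_gen.
by rewrite rmorphM !rmorphXn /= e1 e2 !expr1n mulr1.
Qed.

Lemma restr_linear (V W : lmodType B) (g : V -> W) :
  linear g -> linear (g : restr iota V -> restr iota W).
Proof. by move=> gl a x y; apply: gl. Qed.

Section Along.
Variables (M : lmodType A) (N : lmodType B) (h : M -> restr iota N).
Hypothesis hl : linear h.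
Local Notation LN := (tensor L N).
Local Notation J := (lambda_tensor h).
Local Notation JJ := (lambda_tensor (lambda_tensor h)).

(** [Delta] sends [T^j] to [T^j (x) T^j]: so after [Delta] the coefficient of [T^i] in
    the first factor is [T^i] times the coefficient of [T^i] before. *)
Lemma tensor_coef_Delta i (u : tensor S M) :
  tensor_coef i (JJ (tassoc (tmap Delta id u)) : tensor L LN)
  = tens (lTz B i : L) (tensor_coef i (J u : LN)).
Proof.
have jl := lambda_tensor_linear hl; have jjl := lambda_tensor_linear jl.
have ti := restr_linear (tensor_coef_linear (N := LN) i).
have tn := restr_linear (tensor_coef_linear (N := N) i).
have tl : linear (fun x : N => tens (lTz B i : L) x : LN).
  by move=> a x y; rewrite tensDr tensZr.
have al : linear (@tassoc _ S S M) := tlift_linear (@tassoc_bilinear _ S S M).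
have dl : linear (tmap Delta id : tensor S M -> tensor (tensor S S) M).
  by apply: tmap_linear => //; apply: Delta_linear.
have lhs := linear_comp ti (linear_comp jjl (linear_comp al dl)).
have rhs := linear_comp (restr_linear tl) (linear_comp tn jl).
move: u; apply: (@tensor_eq _ _ _ (restr iota LN) _ _ lhs rhs) => s m; move: s.
have sl : linear (fun s : S => tens s m) by move=> a x y; rewrite tensDl tensZl.
apply: (@G_linear_ext _ _ LN _ _ (linear_comp lhs sl) (linear_comp rhs sl)) => p q.
rewrite tmapE ?Delta_sTpq //; last exact: Delta_linear.
rewrite tassocE (lambda_tensorE jl) (lambda_tensorE hl) lambda_sTpq tensor_coefE.
rewrite (tensor_coefE (N := N)); case: eqP => [->|_]; last first.
  by rewrite !scale0r tens0r.
by rewrite !scale1r.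
Qed.

(** With [tensor_coef_Delta], this turns coassociativity of a coaction [rho] on [M]
    into the statement that the corresponding map [c] on [N] sends the [i]-th
    component [x_i] of [x] to [T^i (x) x_i]. *)
Lemma tensor_coef_coact (rho : M -> tensor S M) (c : N -> LN) :
  linear rho -> linear c -> (forall m, J (rho m) = c (h m)) ->
  forall i u, tensor_coef i (JJ (tmap id rho u) : tensor L LN) = c (tensor_coef i (J u : LN)).
Proof.
move=> rl cl e i; have jl := lambda_tensor_linear hl; have jjl := lambda_tensor_linear jl.
have ml : linear (tmap id rho : tensor S M -> _) by apply: tmap_linear.
have lhs := linear_comp (restr_linear (tensor_coef_linear (N := LN) i))
     (linear_comp jjl ml).
have rhs := linear_comp (restr_linear cl)
  (linear_comp (restr_linear (tensor_coef_linear (N := N) i)) jl).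
apply: (@tensor_eq _ _ _ (restr iota LN) _ _ lhs rhs) => s m.
rewrite tmapE // (lambda_tensorE hl) (lambda_tensorE jl) /tensor_coef !contract_tens;
  try exact: laurent_extend_linear.
by rewrite (linear_morphZ _ _ cl) e.
Qed.

(** Evaluation at [T = 1], the counit of [B[T, T^-1]]. *)
Definition laurent_eps : L -> B^o := @laurent_extend B B^o (fun=> 1).

Lemma laurent_eps_linear : linear laurent_eps. Proof. exact: laurent_extend_linear. Qed.

Lemma counit_bilinear :
  bilinear (fun (s : S) (m : M) => G_eps f s *: m).
Proof.
split=> [m|s] a x y; first by rewrite eps_linear scalerDl scalerA.
by rewrite scalerDr !scalerA mulrC.
Qed.

Lemma contract_counit (u : tensor S M) :
  contract laurent_eps (J u : LN) = h (tlift (fun (s : S) (m : M) => G_eps f s *: m) u).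
Proof.
have jl := lambda_tensor_linear hl.
have cl := restr_linear (contract_linear (N := N) laurent_eps_linear).
have lhs := linear_comp cl jl.
have rhs := linear_comp hl (tlift_linear counit_bilinear).
move: u; apply: (@tensor_eq _ _ _ (restr iota N) _ _ lhs rhs) => s m; move: s.
have sl : linear (fun s : S => tens s m) by move=> a x y; rewrite tensDl tensZl.
apply: (@G_linear_ext _ _ N _ _ (linear_comp lhs sl) (linear_comp rhs sl)) => p q.
rewrite (lambda_tensorE hl) lambda_sTpq contract_tens; last exact: laurent_eps_linear.
rewrite tliftE; last exact: counit_bilinear.
by rewrite eps_sTpq scale1r /laurent_eps laurent_extendE scale1r.
Qed.
End Along.

Lemma lambda_tensor_tmap (M M' : lmodType A) (N N' : lmodType B)
    (h : M -> restr iota N) (h' : M' -> restr iota N') (phi : M -> M') (psi : N -> N') :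
  linear h -> linear h' -> linear phi -> linear psi ->
  (forall m, h' (phi m) = psi (h m)) ->
  forall u, lambda_tensor h' (tmap id phi u) = tmap id psi (lambda_tensor h u : tensor L N).
Proof.
move=> hl hl' phil psil e.
have ml : linear (tmap id phi : tensor S M -> tensor S M') by apply: tmap_linear.
have tl : linear (tmap id psi : tensor L N -> tensor L N') by apply: tmap_linear.
have lhs := linear_comp (lambda_tensor_linear hl') ml.
have rhs := linear_comp (restr_linear tl) (lambda_tensor_linear hl).
apply: (@tensor_eq _ _ _ (restr iota (tensor L N')) _ _ lhs rhs) => s m.
by rewrite tmapE // (lambda_tensorE hl) (lambda_tensorE hl') tmapE // e.
Qed.
End Coassociativity.

(** * The map from a torsion-free module to its localization *)

(** The ring [A (+) M] with [M^2 = 0]. Its localization at [(f, 0)] contains the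
    localization of [M] at [f], for which no separate construction is then needed. *)
Definition trivext (A : comPzRingType) (M : lmodType A) : Type := (A * M)%type.

Section TrivialExtension.
Variables (A : comPzRingType) (M : lmodType A).
Local Notation E := (trivext M).
HB.instance Definition _ := GRing.Zmodule.copy E (A * M)%type.

Let mul (x y : E) : E := (x.1 * y.1, x.1 *: y.2 + y.1 *: x.2).
Let mulA : associative mul.
Proof.
move=> [a m] [b n] [c p]; congr (_, _) => /=; first exact: mulrA.
by rewrite !scalerDr !scalerA addrA (mulrC c a) (mulrC c b).
Qed.
Let mulC : commutative mul.
Proof. by move=> [a m] [b n]; congr (_, _) => /=; [apply: mulrC | apply: addrC]. Qed.
Let mul1 : left_id (1, 0) mul.
Proof. by move=> [a m]; rewrite /mul /= mul1r scale1r scaler0 addr0. Qed.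
Let mulDl : left_distributive mul +%R.
Proof.
move=> [a m] [b n] [c p]; congr (_, _) => /=; first exact: mulrDl.
by rewrite scalerDl scalerDr addrACA.
Qed.
HB.instance Definition _ := GRing.Zmodule_isComPzRing.Build E mulA mulC mul1 mulDl.

Definition te_const (a : A) : E := (a, 0).
Definition te_mod (m : M) : E := (0, m).

Let te_const_add : zmod_morphism te_const.
Proof. by move=> a b; congr (_, _); rewrite subr0. Qed.
Let te_const_mul : monoid_morphism te_const.
Proof. by split=> // a b; congr (_, _); rewrite /= !scaler0 addr0. Qed.
HB.instance Definition _ := GRing.isZmodMorphism.Build A E te_const te_const_add.
HB.instance Definition _ := GRing.isMonoidMorphism.Build A E te_const te_const_mul.

Lemma te_modM a m : te_const a * te_mod m = te_mod (a *: m).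
Proof. by congr (_, _); rewrite /= ?mulr0 // scaler0 addr0. Qed.

Lemma te_modD m n : te_mod (m + n) = te_mod m + te_mod n.
Proof. by congr (_, _); rewrite /= addr0. Qed.
End TrivialExtension.

Section IntoLocalization.
Variables (A : comPzRingType) (f : A) (M : lmodType A).
Local Notation B := (loc f).
Local Notation iota := (loc_const f : {rmorphism A -> B}).
Local Notation E := (trivext M).
Local Notation F := (te_const M f).
Local Notation R := (loc F).

Let theta (x : B) : R :=
  let y := repr (x : {eq_quot (loc_equiv f)}) in frac F (te_const M y.1) y.2.

Let thetaE a n : theta (frac f a n) = frac F (te_const M a) n.
Proof.
have /frac_eq[k e] : frac f (repr (frac f a n : {eq_quot (loc_equiv f)})).1
    (repr (frac f a n : {eq_quot (loc_equiv f)})).2 = frac f a n.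
  by rewrite /frac -surjective_pairing reprK.
by apply/frac_eq; exists k; rewrite -!rmorphXn -!rmorphM e.
Qed.

Let thetaD x y : theta (x + y) = theta x + theta y.
Proof.
elim/frac_ind: x => a n; elim/frac_ind: y => b m.
by rewrite fracD !thetaE fracD rmorphD !rmorphM !rmorphXn.
Qed.

Let thetaM x y : theta (x * y) = theta x * theta y.
Proof.
elim/frac_ind: x => a n; elim/frac_ind: y => b m.
by rewrite fracM !thetaE fracM rmorphM.
Qed.

Let alpha : {rmorphism A -> R} := loc_const F \o te_const M.
Let b (x : restr iota B^o) (m : M) : restr alpha R^o :=
  theta x * loc_const F (te_mod m).

Let bbil : bilinear b.
Proof.
split=> [m|x] a y z; rewrite /b.
  transitivity ((theta (iota a) * theta y + theta z) * loc_const F (te_mod m)).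
    by rewrite -thetaM -thetaD.
  by rewrite thetaE mulrDl -mulrA.
transitivity (theta x * (alpha a * loc_const F (te_mod y) + loc_const F (te_mod z))).
  by rewrite /alpha /= -rmorphM te_modM -rmorphD -te_modD.
by rewrite mulrDr mulrCA.
Qed.

(** The bilinear map [(a / f^n, m) |-> (0, a m) / (f, 0)^n] separates [1 (x) m] from
    [1 (x) n] when [m] and [n] differ: equality of the
    images means [f^k m = f^k n] for some [k]. *)
Lemma to_base_change_inj : injective (fun m : M => f *: m) ->
  injective (@to_base_change _ _ iota M).
Proof.
move=> fI m n /(congr1 (tlift b)); rewrite /to_base_change !tliftE //.
rewrite /b thetaE rmorph1 ![frac F 1 0 * _]mul1r => /frac_eq[k].
rewrite addn0 -rmorphXn !te_modM => /(congr1 snd) /=.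
by elim: k => [|k IH]; rewrite ?expr0 ?scale1r // exprS -!scalerA => /fI.
Qed.
End IntoLocalization.

(** * Gradings as coactions of Laurent polynomials *)

Section GradedModules.
Variables (B : comPzRingType) (N : lmodType B) (gr : int -> submodule N).
Local Notation L := (laurent_mod B).
Hypothesis grP : is_grading gr.

Lemma componentP x : is_decomposition gr x (component gr x).
Proof.
have [c [hc _]] := grP x.
by apply: (@xgetPex _ (fun=> 0) (is_decomposition gr x)); exists c.
Qed.

Lemma component_uniq x c : is_decomposition gr x c -> component gr x = c.
Proof.
have [c' [_ u]] := grP x => hc.
by rewrite -(u _ hc) (u _ (componentP x)).
Qed.

Lemma component_finsupp x : finsupp (component gr x).
Proof. by case: (componentP x). Qed.

Lemma component_linear i : linear (fun x => component gr x i).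
Proof.
move=> a x y; have [fx gx ex] := componentP x; have [fy gy ey] := componentP y.
rewrite (component_uniq (c := fun i => a *: component gr x i + component gr y i)) //.
have aD : {morph (fun v : N => a *: v) : v w / v + w} by move=> v w; rewrite scalerDr.
have [fax eax] := fsum_additive aD fx.
have [fs es] := fsumD fax fy.
split=> // [j|]; first by apply: sub_setP.
by rewrite {1}ex {1}ey eax es.
Qed.

Lemma component_homog i x : gr i x ->
  component gr x = fun j => if j == i then x else 0.
Proof.
move=> gx; apply: component_uniq; pose c j := if j == i then x else 0.
have [fc ec] : finsupp c /\ \sum_(j \in [set: int]) c j = c i.
  by apply: fsum1 => j /negbTE; rewrite /c => ->.
split=> // [j|]; last by rewrite ec /c eqxx.
by case: eqP => [->|_] //; apply: sub_set0.
Qed.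

(** [x |-> \sum_i T^i (x) x_i]. *)
Definition graded_coact (x : N) : tensor L N := laurent_sum (component gr x).

Lemma tensor_coef_graded_coact i x : tensor_coef i (graded_coact x) = component gr x i.
Proof. exact/tensor_coef_laurent_sum/component_finsupp. Qed.

Lemma graded_coact_linear : linear graded_coact.
Proof.
move=> a x y; apply: laurent_tensor_ext => i.
by rewrite tensor_coef_linear !tensor_coef_graded_coact component_linear.
Qed.

Lemma graded_coact_homog i x : gr i x <-> graded_coact x = tens (lTz B i : L) x.
Proof.
split=> [gx|/(congr1 (tensor_coef i))]; last first.
  rewrite tensor_coef_graded_coact tensor_coefE eqxx scale1r => <-.
  by case: (componentP x).
rewrite /graded_coact /laurent_sum (component_homog gx) (fsum1 (i := i) _).2 ?eqxx //.
by move=> j /negbTE ->; exact: tens0r.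
Qed.
End GradedModules.

(** * The pair attached to a comodule *)

Section PairMap.
Variables (A : comPzRingType) (f : A) (X : gpair f).
Local Notation B := (loc f).
Local Notation iota := (loc_const f : {rmorphism A -> B}).

Lemma gpair_map_bilinear :
  bilinear (fun (b : restr iota B^o) (m : submod_type (pM X)) =>
    ((b : B) *: (val m : pN X) : restr iota (pN X))).
Proof.
split=> [m|b] a x y.
  exact: etrans (scalerDl (val m : pN X) (iota a * (x : B)) (y : B))
    (congr1 (+%R^~ _) (esym (scalerA _ _ _))).
transitivity ((b : B) *: (iota a *: (val x : pN X) + (val y : pN X))) => //.
by rewrite scalerDr scalerA mulrC -scalerA.
Qed.

Lemma gpair_map_tens (b : B) m :
  gpair_map (X := X) (tens (b : restr iota B^o) m) = b *: (val m : pN X).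
Proof. exact: tliftE gpair_map_bilinear. Qed.

Lemma gpair_mapD : {morph gpair_map (X := X) : x y / x + y}.
Proof. exact: linear_morphD (tlift_linear gpair_map_bilinear). Qed.

Lemma gpair_map_linear : linear (gpair_map (X := X)).
Proof.
suff FZ b x : gpair_map (X := X) (b *: x) = b *: gpair_map x.
  by move=> b x y; rewrite gpair_mapD FZ.
move: x; apply: (@tensor_eqD _ _ _ _ (fun x => gpair_map (X := X) (b *: (x : base_change iota _)))
    (fun x => b *: gpair_map (X := X) x)) => [x y|x y|c m].
- by rewrite -gpair_mapD -scalerDr.
- by rewrite -scalerDr -gpair_mapD.
- by rewrite base_changeZ !gpair_map_tens scalerA.
Qed.
End PairMap.

Section ObjectsOfF.
Variables (A : comPzRingType) (f : A) (M : RepG f).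
Local Notation B := (loc f).
Local Notation iota := (loc_const f : {rmorphism A -> B}).
Local Notation L := (laurent_mod B).
Local Notation S := (G_mod f).
Local Notation N := (base_change iota (cmod M)).
Local Notation LN := (tensor L N).
Local Notation h := (@to_base_change _ _ iota (cmod M)).
Local Notation hl := (@to_base_change_linear _ _ iota (cmod M)).

Lemma F_coact_h m : F_coact (h m) = lambda_tensor h (coact m).
Proof. by rewrite F_coact_tens scale1r. Qed.

(** Coassociativity: the [i]-th component of [x] lies in the degree [i] part. *)
Lemma F_coact_tensor_coef i (x : N) :
  F_coact (tensor_coef i (F_coact x)) = tens (lTz B i : L) (tensor_coef i (F_coact x)).
Proof.
have cl := @F_coact_linear _ _ M; have tl := tensor_coef_linear (N := N) i.
have cD := linear_morphD cl; have tD := linear_morphD tl.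
move: x; apply: tensor_eqD => [x y|x y|b m].
- by rewrite cD tD cD.
- by rewrite cD tD tensDr.
rewrite F_coact_tens (linear_morphZ _ _ tl) (linear_morphZ _ _ cl) tensZr.
have E := tensor_coef_coact hl (@coact_linear _ _ _ _ M) cl (fun m => esym (F_coact_h m)).
by congr (_ *: _); rewrite -/(lambda_tensor h) -E -(tensor_coef_Delta hl) -(coactA m).
Qed.

(** Counitality: [x] is the sum of its components. *)
Lemma F_coact_counit (x : N) : contract (laurent_eps (f := f)) (F_coact x) = x.
Proof.
have el := contract_linear (N := N) (laurent_eps_linear (f := f)).
move: x; apply: tensor_eqD => [x y|//|b m].
  by rewrite (linear_morphD (@F_coact_linear _ _ M)) (linear_morphD el).
rewrite F_coact_tens (linear_morphZ _ _ el) -/(lambda_tensor h) (contract_counit hl) coact1.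
by rewrite base_changeZ mulr1.
Qed.

Lemma F_decomposition (x : N) :
  is_decomposition (F_gr M) x (fun i => tensor_coef i (F_coact x)).
Proof.
have [fs e] := laurent_sumP (F_coact x); split=> // [i|]; first exact: F_coact_tensor_coef.
rewrite -{1}[x]F_coact_counit [X in contract _ X]e (contract_laurent_sum (laurent_eps_linear (f
  := f)) fs).
by apply: eq_fsbigr => i _; rewrite /laurent_eps laurent_extendE scale1r.
Qed.

Lemma F_is_grading : is_grading (F_gr M).
Proof.
move=> x; exists (fun i => tensor_coef i (F_coact x)); split; first exact: F_decomposition.
move=> c [fc gc ec]; apply/funext => i.
have cD := linear_morphD (@F_coact_linear _ _ M).
have -> : F_coact x = laurent_sum c.
  rewrite {1}ec (fsum_additive cD fc).2; apply: eq_fsbigr => j _; exact: gc.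
exact: tensor_coef_laurent_sum.
Qed.

Lemma F_component (x : N) i : component (F_gr M) x i = tensor_coef i (F_coact x).
Proof.
by rewrite (component_uniq F_is_grading (F_decomposition x)).
Qed.

(** [C_n x] is the coefficient of [X^n] in [\sum_i T^i (x) x_i], which for [x] in [M] is
    the coaction of [x], an element of [S (x) M]. *)
Lemma F_gpair_C n x : F_lattice M x -> F_lattice M (gpair_C (X := F_obj M) n x).
Proof.
move=> [m ->]; have [m' e] := taylor_coef_lambda_tensor hl n (coact m); exists m'.
rewrite -e -F_coact_h; have [fs e'] := laurent_sumP (F_coact (h m)).
rewrite [X in contract _ X]e' (contract_laurent_sum (taylor_coef_linear n) fs).
by apply: eq_fsbigr => i _; rewrite taylor_coefE F_component.
Qed.

(** From [M] to the lattice of its pair, the image of [M] in [B (x) M]. It is onto, and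
    bijective when [f] is injective on [M]; it is then the unit of the equivalence. *)
Definition to_lattice (m : M) : submod_type (F_lattice M) :=
  exist _ (h m : restr iota N) (asboolT (ex_intro _ m erefl)).

Lemma to_lattice_linear : linear to_lattice.
Proof. by move=> a x y; apply: val_inj; apply: hl. Qed.

Lemma to_lattice_surj x : exists m, x = to_lattice m.
Proof. by have [m e] := submod_typeP x; exists m; apply: val_inj. Qed.

Lemma F_gpair_map_bij : bijective (gpair_map (X := F_obj M)).
Proof.
have tl : linear (tmap (M := restr iota B^o) id to_lattice).
  exact: tmap_linear to_lattice_linear.
have tD := linear_morphD tl; have gD := @gpair_mapD _ _ (F_obj M).
exists (tmap id to_lattice).
  apply: tensor_eqD => [x y|//|b x]; first by rewrite gD tD.
  have [m ->] := to_lattice_surj x.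
  rewrite gpair_map_tens /= base_changeZ mulr1.
  by rewrite (tmapE _ _ _ to_lattice_linear).
apply: tensor_eqD => [x y|//|b m]; first by rewrite tD gD.
rewrite (tmapE _ _ _ to_lattice_linear) // gpair_map_tens /=.
by rewrite base_changeZ mulr1.
Qed.

Lemma F_in_C : in_C (F_obj M).
Proof. split; [exact: F_is_grading | exact: F_gpair_map_bij | exact: F_gpair_C]. Qed.
End ObjectsOfF.

(** * Finite expansions in powers of X *)

Section TaylorExpansion.
Variables (A : comPzRingType) (f : A).
Local Notation B := (loc f).
Local Notation iota := (loc_const f : {rmorphism A -> B}).
Local Notation L := (laurent_mod B).
Local Notation S := (G_mod f).
Local Notation lam := (lambda f).

Lemma shifted_coef_lTz r n i :
  shifted_coef (f := f) r n (lTz B i) = iota f ^+ n * (binz (r%:Z + i) n)%:~R.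
Proof. by rewrite /shifted_coef -lTzD taylor_coefE. Qed.

Lemma lT_exp p K : (p < K)%N ->
  lT B ^+ p = \sum_(n < K) (iota f ^+ n * 'C(p, n)%:R) *: (lX f ^+ n : L) :> L.
Proof.
move=> pK; rewrite lT_lX exprDn.
rewrite (big_ord_widen _ (fun i => 1 ^+ (p - i)
  * (iota f *: (lX f : L) : laurent B) ^+ i *+ 'C(p, i)) pK).
rewrite big_mkcond; apply: eq_bigr => n _; rewrite expr1n mul1r.
case: ltnP => [_|pn]; last by rewrite bin_small // mulr0 scale0r.
have -> : (iota f *: (lX f : L) : laurent B) ^+ n = iota f ^+ n *: (lX f ^+ n : L).
  transitivity ((laurent_struct B (iota f) * lX f) ^+ n); first by [].
  by rewrite exprMn -(rmorphXn (laurent_struct B)).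
by rewrite mulr_natr -scalerMnl.
Qed.

Lemma taylor r K i : (`|(r%:Z + i)%R| < K)%N -> (0 <= r%:Z + i)%R ->
  lTz B i = \sum_(n < K) (shifted_coef r n (lTz B i : L) : B) *: (lam (TX_mon f r n) : L).
Proof.
move=> iK i0; have [p ep] : exists p : nat, r%:Z + i = p by exists `|(r%:Z + i)%R|%N; lia.
have e : lTz B i = lTz B (- r%:Z) * lT B ^+ p.
  by rewrite -[lT B ^+ p]/(lTz B p) -lTzD -ep addKr.
have pK : (p < K)%N by move: iK; rewrite ep.
have ml := laurent_mul_linear (lTz B (- r%:Z)).
rewrite {1}e (lT_exp pK) (additive_sum (V := L) (W := L) _ _ (linear_morphD ml)).
apply: eq_bigr => n _; rewrite (linear_morphZ (V := L) _ _ ml) lambda_TX_mon.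
by rewrite shifted_coef_lTz ep binz_nat.
Qed.

(** For [r] large [T^r w] only involves powers [T^p] with [p >= 0], which are
    polynomials in [X]; so its expansion is finite and recovers [w]. Hence [w] comes
    from [S (x) M] as soon as these coefficients lie in [M]. *)
Lemma taylor_tensor (N : lmodType B) (w : tensor L N) : exists r K,
  w = \sum_(n < K) tens (lam (TX_mon f r n) : L) (contract (shifted_coef r n) w).
Proof.
have [/finsuppP[s [us hs]] ew] := laurent_sumP w.
have [r hr] : exists r : nat, forall i, i \in s -> (`|i| <= r)%N.
  elim: {us hs} s => [|i s [r hr]]; first by exists 0%N.
  exists (`|i| + r)%N => j; rewrite inE => /orP[/eqP ->|/hr]; lia.
(* The exponents [r + i] then lie between [0] and [2 r]. *)
exists r, (r + r).+1; pose x i := tensor_coef i w; have hx i : i \notin s -> x i = 0 := hs i.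
have ew' : w = \sum_(i <- s) tens (lTz B i : L) (x i).
  rewrite {1}ew /laurent_sum; apply: fsumE => // i /hx; rewrite /x => ->; exact: tens0r.
have E n : contract (shifted_coef r n) w = \sum_(i <- s) (shifted_coef r n (lTz B i : L) : B)
  *: x i.
  have cD := linear_morphD (contract_linear (N := N) (shifted_coef_linear (f := f) r n)).
  rewrite {1}ew' (additive_sum _ _ cD); apply: eq_bigr => i _.
  by rewrite contract_tens //; apply: shifted_coef_linear.
under eq_bigr => n _ do rewrite E (additive_sum _ _ (tens_additive _)).
rewrite exchange_big {1}ew'; apply: eq_big_seq => i /hr ir.
rewrite {1}(@taylor r (r + r).+1 i); [|lia|lia].
rewrite (additive_sum (V := L) _ _ (fun y z => tensDl y z (x i))).
by apply: eq_bigr => n _; rewrite tensZl tensZr.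
Qed.

Lemma contract_lin_comb (N : lmodType B) (b : B) (phi psi chi : L -> B^o) :
  linear phi -> linear psi -> linear chi ->
  (forall l, phi l = psi l + b * chi l) ->
  forall w : tensor L N, contract phi w = contract psi w + b *: contract chi w.
Proof.
move=> phil psil chil e.
have D1 := linear_morphD (contract_linear (N := N) phil).
have D2 := linear_morphD (contract_linear (N := N) psil).
have D3 := linear_morphD (contract_linear (N := N) chil).
apply: tensor_eqD => [//|x y|l x]; first by rewrite D2 D3 scalerDr addrACA.
by rewrite !contract_tens // e scalerDl scalerA.
Qed.
End TaylorExpansion.

(** * The comodule attached to a pair *)

Section ComoduleOfPair.
Variables (A : comPzRingType) (f : A) (X : gpair f).
Local Notation B := (loc f).
Local Notation iota := (loc_const f : {rmorphism A -> B}).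
Local Notation L := (laurent_mod B).
Local Notation S := (G_mod f).
Local Notation N := (pN X).
Local Notation LN := (tensor L N).
Local Notation M := (submod_type (pM X)).
Hypothesis XC : in_C X.

Definition lattice_incl (m : M) : restr iota N := val m.

Lemma lattice_incl_linear : linear lattice_incl.
Proof. exact: val_submodP. Qed.

Lemma lattice_incl_inj : injective lattice_incl. Proof. exact: val_inj. Qed.

Let grP : is_grading (pgr X). Proof. by case: XC. Qed.
Local Notation c := (graded_coact (pgr X)).

Lemma gpair_C_contract n x : gpair_C n x = contract (taylor_coef n) (c x).
Proof.
rewrite /graded_coact (contract_laurent_sum (taylor_coef_linear n) (component_finsupp grP x)).
by apply: eq_fsbigr => i _; rewrite taylor_coefE.
Qed.

(** Induction on [r]: multiplying by [T = 1 + f X] replaces the coefficient of [X^n]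
    by its sum with [f] times that of [X^(n - 1)]. For [r = 0] this is the stability
    of the lattice under [C_n]. *)
Lemma lattice_shifted_coef r n x : pM X x -> pM X (contract (shifted_coef r n) (c x)).
Proof.
move=> Mx; elim: r n => [|r IH] n.
  have -> : shifted_coef (f := f) 0 n = taylor_coef n.
    by apply/funext => l; rewrite /shifted_coef /= expr0 mul1r.
  by rewrite -gpair_C_contract; have [_ _ hC] := XC; apply: hC.
have e l : lTz B r.+1 * (l : laurent B) = lT B * (lTz B r * l).
  by rewrite mulrA -lTzS; congr (lTz B _ * _); lia.
case: n => [|n].
  have -> : shifted_coef (f := f) r.+1 0 = shifted_coef r 0; last exact: IH.
  by apply/funext => l; rewrite /shifted_coef e taylor_coef0T.
rewrite (@contract_lin_comb _ f _ (iota f) _ (shifted_coef r n.+1) (shifted_coef r n));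
  try exact: shifted_coef_linear.
  by rewrite addrC; apply: (@sub_setP _ _ (pM X) f); apply: IH.
by move=> l; rewrite /shifted_coef e taylor_coefST.
Qed.

(** All coefficients of the finite expansion of [\sum_i T^i (x) m_i] lie in the
    lattice. *)
Lemma coact_exists (m : M) : exists u : tensor S M, lambda_tensor lattice_incl u = c (val m).
Proof.
have [r [K e]] := taylor_tensor (c (val m)).
have mem n := lattice_shifted_coef r n (submod_typeP m).
pose d n : M := exist _ (contract (shifted_coef r n) (c (val m)) : restr iota N) (asboolT (mem
  n)).
exists (X_expansion f r K d); rewrite {1}e /X_expansion.
rewrite (additive_sum _ _ (linear_morphD (lambda_tensor_linear lattice_incl_linear))).
by apply: eq_bigr => n _; rewrite (lambda_tensorE lattice_incl_linear).
Qed.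

Definition pair_coact (m : M) : tensor S M := sval (cid (coact_exists m)).

Lemma lambda_tensor_pair_coact m : lambda_tensor lattice_incl (pair_coact m) = c (lattice_incl m).
Proof. by rewrite /pair_coact; case: cid. Qed.

Let jI := lambda_tensor_inj lattice_incl_linear lattice_incl_inj.
Let jl := lambda_tensor_linear lattice_incl_linear.

Lemma pair_coact_linear : linear pair_coact.
Proof.
move=> a x y; apply: jI; rewrite jl !lambda_tensor_pair_coact.
by rewrite lattice_incl_linear; apply: (graded_coact_linear grP).
Qed.

(** By [tensor_coef_Delta] and [tensor_coef_coact], both sides have [i]-th coefficient
    [T^i (x) m_i]. *)
Lemma pair_coactA m :
  tassoc (tmap (Delta (f := f)) id (pair_coact m)) = tmap id pair_coact (pair_coact m).
Proof.
apply: (lambda_tensor_inj jl jI); apply: (@laurent_tensor_ext B LN) => i.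
rewrite (tensor_coef_Delta lattice_incl_linear).
rewrite (tensor_coef_coact lattice_incl_linear pair_coact_linear (graded_coact_linear grP)
  lambda_tensor_pair_coact).
rewrite lambda_tensor_pair_coact (tensor_coef_graded_coact grP).
by symmetry; apply/(graded_coact_homog grP); case: (componentP grP (lattice_incl m)).
Qed.

Lemma pair_coact1 m : tlift (fun (s : S) (m' : M) => G_eps f s *: m') (pair_coact m) = m.
Proof.
apply: lattice_incl_inj; rewrite -(contract_counit lattice_incl_linear)
  lambda_tensor_pair_coact /graded_coact.
rewrite (contract_laurent_sum (laurent_eps_linear (f := f)) (component_finsupp grP _)).
have [_ _ e] := componentP grP (lattice_incl m); rewrite [RHS]e.
by apply: eq_fsbigr => i _; rewrite /laurent_eps laurent_extendE scale1r.
Qed.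

Definition pair_comodule : RepG f :=
  Comodule pair_coact_linear pair_coactA pair_coact1.

Lemma pair_torsionfree : injective (fun m : cmod pair_comodule => f *: m).
Proof.
move=> x y e; apply: lattice_incl_inj; apply: (@loc_scaleI _ f N).
exact: (congr1 lattice_incl e).
Qed.
End ComoduleOfPair.

(** * The equivalence *)

Lemma nat_isomorphic_sym (C D : category) (F G : functor C D) :
  nat_isomorphic F G -> nat_isomorphic G F.
Proof.
move=> [eta [nat iso]].
pose inv X := sval (cid (iso X)).
have invP X : cmp (inv X) (eta X) = idm (F X) /\ cmp (eta X) (inv X) = idm (G X).
  by rewrite /inv; case: cid.
exists inv; split=> [X Y u|X]; last by exists (eta X); have [] := invP X.
have [l _] := invP Y; have [_ r] := invP X.
by rewrite -[fmap G u]cmpm1 -r [cmp (fmap G u) _]cmpA -nat !cmpA l cmp1m.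
Qed.

Section Equivalence.
Variables (A : comPzRingType) (f : A).
Local Notation B := (loc f).
Local Notation iota := (loc_const f : {rmorphism A -> B}).

Lemma comodule_iso (M M' : RepG f) (g : hom M M') : bijective (chom g) -> is_iso g.
Proof.
move=> [k gk kg]; have gl := chom_linear g.
have kl : linear k.
  by move=> a x y; rewrite -{1}[x]kg -{1}[y]kg -gl gk.
have kc m : coact (k m) = tmap id k (coact m).
  rewrite -{2}[m]kg (chom_coact g).
  have sl : linear (tmap id (chom g) : tensor (G_mod f) _ -> _) by apply: tmap_linear.
  have tl : linear (tmap id k : tensor (G_mod f) _ -> _) by apply: tmap_linear.
  move: (coact (k m)); apply: tensor_eq => [//||s n]; first exact: linear_comp.
  by rewrite !tmapE // gk.
exists (ComoduleHom kl kc).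
by split; apply: comodule_hom_eq => x; rewrite /= ?gk ?kg.
Qed.

Lemma gpair_hom_graded_coact (X Y : gpair f) (u : gpair_hom X Y) :
  is_grading (pgr X) -> is_grading (pgr Y) ->
  forall x, graded_coact (pgr Y) (u x) = tmap id u (graded_coact (pgr X) x).
Proof.
move=> gX gY x; have ul := phom_linear u; have uD := linear_morphD ul.
have [fx cx ex] := componentP gX x; have [fu eu] := fsum_additive uD fx.
have tD : {morph (tmap (M := laurent_mod B) id u) : x y / x + y}.
  by apply: linear_morphD; apply: tmap_linear.
have -> : graded_coact (pgr Y) (u x) = laurent_sum (fun i => u (component (pgr X) x i)).
  rewrite /graded_coact (component_uniq gY (c := fun i => u (component (pgr X) x i))) //.
  split=> // [i|]; first exact/phom_graded/cx.
  by rewrite {1}ex eu.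
rewrite /graded_coact /laurent_sum (fsum_additive tD (finsupp_tens fx)).2.
by apply: eq_fsbigr => i _; rewrite tmapE.
Qed.

Section Restriction.
Variables (X Y : gpair f) (u : gpair_hom X Y) (XC : in_C X) (YC : in_C Y).
Local Notation M := (submod_type (pM X)).
Local Notation M' := (submod_type (pM Y)).

Definition lattice_map (m : M) : M' :=
  exist _ (u (val m) : restr iota (pN Y))
    (asboolT (phom_lattice u (submod_typeP m))).

Lemma lattice_map_linear : linear lattice_map.
Proof.
move=> a x y; apply: val_inj; exact: (phom_linear u (iota a) (val x) (val y)).
Qed.

(** Seen in [L (x) N], the two sides are the images under a graded map of the same
    [\sum_i T^i (x) x_i]. *)
Lemma lattice_map_coact (m : M) :
  pair_coact YC (lattice_map m) = tmap id lattice_map (pair_coact XC m).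
Proof.
apply: (lambda_tensor_inj (@lattice_incl_linear _ _ Y) (@lattice_incl_inj _ _ Y));
  rewrite lambda_tensor_pair_coact.
rewrite (lambda_tensor_tmap (@lattice_incl_linear _ _ X) (@lattice_incl_linear _ _ Y)
  lattice_map_linear
  (phom_linear u)) // lambda_tensor_pair_coact.
by apply: gpair_hom_graded_coact; [case: XC | case: YC].
Qed.

Definition pair_comodule_hom : hom (pair_comodule XC) (pair_comodule YC) :=
  ComoduleHom (M := pair_comodule XC) (M' := pair_comodule YC)
    lattice_map_linear lattice_map_coact.
End Restriction.

Definition lattice_functor : functor (catC f) (RepG_f f).
Proof.
apply: (@Functor (catC f) (RepG_f f)
  (fun X => exist _ (pair_comodule (svalP X)) (@pair_torsionfree _ _ _ (svalP X)))
  (fun X Y u => pair_comodule_hom u (svalP X) (svalP Y))).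
- by move=> X; apply: comodule_hom_eq => x; apply: val_inj.
- by move=> X Y Z v u; apply: comodule_hom_eq => x; apply: val_inj.
Defined.

Definition functor_F_in_C (M : RepG_f f) : in_C (functor_F_raw f M) := F_in_C (sval M).

Local Notation FF := (functor_F functor_F_in_C).

Section Unit.
Variable M : RepG f.
Local Notation h := (@to_base_change _ _ iota (cmod M)).
Local Notation hl := (@to_base_change_linear _ _ iota (cmod M)).

(** The grading on [B (x) M] was defined so that its coaction is the extension of
    that of [M]. *)
Lemma graded_coact_F x : graded_coact (F_gr M) x = F_coact x.
Proof.
by rewrite [RHS](laurent_sumP _).2; congr laurent_sum; apply/funext => i; rewrite F_component.
Qed.

(** The coaction built on the lattice is the original one, as both have the same
    image in [L (x) N]. *)
Lemma to_lattice_coact (XC : in_C (F_obj M)) m :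
  pair_coact XC (to_lattice m) = tmap id (@to_lattice _ _ M) (coact m).
Proof.
apply: (lambda_tensor_inj (@lattice_incl_linear _ _ (F_obj M)) (@lattice_incl_inj _ _ (F_obj M))).
rewrite lambda_tensor_pair_coact graded_coact_F [lattice_incl _]/= F_coact_h.
rewrite (lambda_tensor_tmap (psi := id) hl (@lattice_incl_linear _ _ (F_obj M))
  (@to_lattice_linear _ _ M)) //.
by rewrite tmap_id.
Qed.

Definition unit_hom (XC : in_C (F_obj M)) : hom M (pair_comodule XC) :=
  ComoduleHom (M := M) (M' := pair_comodule XC)
    (@to_lattice_linear _ _ M) (to_lattice_coact XC).

Lemma unit_iso XC : injective (fun m : M => f *: m) -> is_iso (unit_hom XC).
Proof.
move=> fI; apply: comodule_iso.
have tI : injective (@to_lattice _ _ M).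
  move=> x y /(congr1 val); exact: to_base_change_inj.
pose k (x : submod_type (F_lattice M)) := sval (cid (to_lattice_surj x)).
have kP x : to_lattice (k x) = x by rewrite /k; case: cid.
by exists k => x; [apply: tI; apply: kP | apply: kP].
Qed.
End Unit.

Lemma lattice_functor_F : nat_isomorphic (functor_comp lattice_functor FF) (functor_id (RepG_f
  f)).
Proof.
apply: nat_isomorphic_sym.
exists (fun M => unit_hom (svalP (FF M))); split=> [M M' u|M].
  apply: comodule_hom_eq => m; apply: val_inj.
  by rewrite /= F_map_tens.
exact/unit_iso/(svalP M).
Qed.

Section Counit.
Variables (X : gpair f) (XC : in_C X).
Local Notation P := (pair_comodule XC).

Lemma gpair_map_coact x :
  graded_coact (pgr X) (gpair_map x) = tmap id (gpair_map (X := X)) (F_coact (M := P) x).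
Proof.
have grP : is_grading (pgr X) by case: XC.
have gl := @gpair_map_linear _ _ X; have cl := graded_coact_linear grP.
have tl : linear (tmap (M := laurent_mod B) id (gpair_map (X := X))) by apply: tmap_linear.
have Fl := @F_coact_linear _ _ P.
move: x; apply: tensor_eqD => [x y|x y|b m].
- by rewrite (linear_morphD gl) (linear_morphD cl).
- by rewrite (linear_morphD Fl) (linear_morphD tl).
rewrite F_coact_tens gpair_map_tens (linear_morphZ _ _ tl) (linear_morphZ _ _ cl).
congr (_ *: _); rewrite -(lambda_tensor_pair_coact XC m).
rewrite -(lambda_tensor_tmap (phi := id) (@to_base_change_linear _ _ iota (cmod P))
  (@lattice_incl_linear _ _ X) _ gl) //.
  by rewrite tmap_id.
by move=> n; rewrite gpair_map_tens scale1r.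
Qed.

Lemma gpair_map_graded i x : F_gr P i x -> pgr X i (gpair_map (X := X) x).
Proof.
move=> /= e; have grP : is_grading (pgr X) by case: XC.
by apply/(graded_coact_homog grP); rewrite gpair_map_coact e tmapE //; apply: gpair_map_linear.
Qed.

Lemma gpair_map_lattice x : F_lattice P x -> pM X (gpair_map (X := X) x).
Proof. by move=> [m ->]; rewrite gpair_map_tens scale1r; apply: submod_typeP. Qed.

(** [B (x) M -> N], bijective by assumption on pairs; it is graded because it
    intertwines the coactions of [B[T, T^-1]]. *)
Definition counit_hom : gpair_hom (F_obj P) X :=
  @GPairHom _ _ (F_obj P) X (gpair_map (X := X)) (@gpair_map_linear _ _ X)
    gpair_map_graded gpair_map_lattice.

Lemma counit_iso : is_iso (C := gpair_category f) counit_hom.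
Proof.
have grP : is_grading (pgr X) by case: XC.
have [_ [k gk kg] _] := XC; have gl := @gpair_map_linear _ _ X.
have kl : linear (k : pN X -> base_change iota (cmod P)).
  by move=> a x y; rewrite -[RHS]gk gl !kg.
have kgr i x : pgr X i x -> F_gr P i (k x).
  move=> /(graded_coact_homog grP) e /=.
  have t1 : linear (tmap (M := laurent_mod B) id (gpair_map (X := X))) by apply: tmap_linear.
  have t2 : linear (tmap (M := laurent_mod B) id (k : pN X -> base_change iota (cmod P))).
    by apply: tmap_linear.
  have tK w : tmap id (k : pN X -> base_change iota (cmod P)) (tmap id (gpair_map (X := X)) w) = w
      :> tensor (laurent_mod B) (base_change iota (cmod P)).
    move: w; apply: tensor_eq => [|//|l y]; first exact: linear_comp.
    by rewrite !tmapE // gk.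
  by rewrite -[LHS]tK -gpair_map_coact kg e tmapE.
have kla x : pM X x -> F_lattice P (k x).
  move=> Mx; pose m : submod_type (pM X) := exist _ (x : restr iota (pN X)) (asboolT Mx).
  exists m; rewrite -[RHS]gk; congr k.
  by rewrite gpair_map_tens scale1r.
exists (@GPairHom _ _ X (F_obj P) k kl kgr kla).
by split; apply: gpair_hom_eq => x; [apply: gk | apply: kg].
Qed.
End Counit.

Lemma F_lattice_functor : nat_isomorphic (functor_comp FF lattice_functor) (functor_id (catC f)).
Proof.
exists (fun X => counit_hom (svalP X)); split=> [X Y u|X]; last exact: counit_iso.
apply: gpair_hom_eq; apply: tensor_eqD => [x y|x y|b m].
- by rewrite /= (linear_morphD (F_map_linear _)) gpair_mapD.
- by rewrite /= gpair_mapD (linear_morphD (phom_linear u)).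
rewrite /= F_map_tens !gpair_map_tens.
by rewrite (linear_morphZ _ _ (phom_linear u)).
Qed.
End Equivalence.

Theorem theorem1p3p1 (A : comPzRingType) (f : A) (f_nzd : GRing.lreg f) :
  exists H : (forall M : RepG_f f, in_C (functor_F_raw f M)),
    is_equivalence (functor_F H).
Proof.
exists (@functor_F_in_C A f); exists (lattice_functor f); split;
  [exact: lattice_functor_F | exact: F_lattice_functor].
Qed.
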